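(* Let $m,n$ be positive integers, let $\mu,\nu$ be two (positive) partitions, and let $u_1,\dots,u_m$, $x_1,\dots,x_n$ be complex numbers with $su_i\neq1$ for all $i$. The (skew) stable spin Hall--Littlewood functions and dual (skew) spin $q$-Whittaker polynomials satisfy $$ \sum_{\lambda} \widetilde{\mathsf F}_{\lambda/\mu}(u_1,\dots,u_m)\, \mathbb{F}^{*}_{\lambda'/\nu'}(x_1,\dots,x_n) = \prod_{i=1}^{m}\prod_{j=1}^{n} \left(\frac{1+u_ix_j}{1-su_i}\right) \sum_{\kappa} \widetilde{\mathsf F}_{\nu/\kappa}(u_1,\dots,u_m)\, \mathbb{F}^{*}_{\mu'/\kappa'}(x_1,\dots,x_n), $$ where both sums are over (positive) partitions.
   Context: Fix $q,s\in\mathbb{C}$ with $|q|<1$, $|s|<1$. Write $(a;q)_m=\prod_{i=1}^m(1-aq^{i-1})$ for $m\ge 1$, $(a;q)_0=1$, $(a;q)_\infty=\prod_{i\ge1}(1-aq^{i-1})$. A (positive) partition is a finite, possibly empty, sequence $\lambda_1\ge\dots\ge\lambda_\ell\ge1$ of integers, with $\lambda_i:=0$ for $i>\ell$; $m_i(\lambda)=\#\{j:\lambda_j=i\}$ for $i\ge1$; $\lambda'$ is the conjugate partition, so $m_i(\lambda')=\lambda_i-\lambda_{i+1}$. Spin $q$-Whittaker polynomials. For $x\in\mathbb{C}$ and $i,j,k,\ell\in\mathbb{Z}_{\ge0}$, $$W_x(i,j;k,\ell)=\mathbf 1_{i+j=k+\ell}\,\mathbf 1_{i\ge\ell}\;x^\ell\frac{(-s/x;q)_\ell\,(-sx;q)_{i-\ell}\,(q;q)_k}{(q;q)_\ell\,(q;q)_{i-\ell}\,(s^2;q)_k},$$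 where $x^\ell(-s/x;q)_\ell$ is read as $\prod_{r=0}^{\ell-1}(x+sq^r)$. For partitions $\lambda,\mu$, $$\mathbb{F}_{\lambda/\mu}(x_1,\dots,x_n)=\sum\prod_{r=1}^n\left[x_r^{h_{r,0}}\frac{(-s/x_r;q)_{h_{r,0}}}{(q;q)_{h_{r,0}}}\prod_{c\ge1}W_{x_r}\big(v_{r-1,c},h_{r,c-1};v_{r,c},h_{r,c}\big)\right],$$ the sum running over all non-negative integers $h_{r,c}$ ($1\le r\le n$, $c\ge0$), with $h_{r,c}=0$ for all large $c$, and $v_{r,c}$ ($0\le r\le n$, $c\ge1$) subject to $v_{0,c}=\mu_c-\mu_{c+1}$ and $v_{n,c}=\lambda_c-\lambda_{c+1}$ (all but finitely many weights equal $1$ in any nonzero term). The dual polynomials are $$\mathbb{F}^*_{\lambda/\mu}=\frac{\tilde c_{\lambda'}}{\tilde c_{\mu'}}\,\mathbb{F}_{\lambda/\mu},\qquad \tilde c_{\lambda}=\prod_{i\ge1}\frac{(s^2;q)_{m_i(\lambda)}}{(q;q)_{m_i(\lambda)}}.$$ Stable spin Hall--Littlewood functions. For $i,k\in\mathbb{Z}_{\ge0}$ and $j,\ell\in\{0,1\}$ let $w_u(i,j;k,\ell)$ be zero unless $i+j=k+\ell$, and for $g\in\mathbb{Z}_{\ge0}$ $$w_u(g,0;g,0)=\tfrac{1-sq^gu}{1-su},\quad w_u(g+1,0;g,1)=\tfrac{(1-s^2q^g)u}{1-su},\quad w_u(g,1;g+1,0)=\tfrac{1-q^{g+1}}{1-su},\quad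 w_u(g,1;g,1)=\tfrac{u-sq^g}{1-su}.$$ For partitions $\lambda,\mu$ put $$\langle\!\langle\mu|\widetilde C(u)|\lambda\rangle\!\rangle=\sum_{h_0,h_1,\ldots}u^{h_0}\prod_{c\ge1}w_u\big(m_c(\mu),h_{c-1};m_c(\lambda),h_c\big),$$ the sum over sequences $h_c\in\{0,1\}$ with $h_c=0$ for all large $c$. The skew stable spin Hall--Littlewood function is $\widetilde{\mathsf F}_{\lambda/\mu}(u_1,\dots,u_m)=\langle\!\langle\mu|\widetilde C(u_1)\cdots\widetilde C(u_m)|\lambda\rangle\!\rangle$, i.e. $\sum\prod_{r=1}^m\langle\!\langle\nu^{(r-1)}|\widetilde C(u_r)|\nu^{(r)}\rangle\!\rangle$ over chains of partitions $\nu^{(0)}=\mu,\nu^{(1)},\dots,\nu^{(m)}=\lambda$. *)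

(* Defs.v *)
From HB Require Import structures.
From mathcomp Require Import all_boot all_order all_algebra.
From mathcomp Require Import boolp classical_sets cardinality fsbigop.
From mathcomp Require Import reals complex zify.

Set Implicit Arguments.
Unset Strict Implicit.
Unset Printing Implicit Defensive.

Import Order.TTheory GRing.Theory Num.Theory.

Local Open Scope classical_set_scope.
Local Open Scope ring_scope.

(* The infinite sums and products below are the finitely supported operators of
   fsbigop, whose value is the neutral element when the support is infinite.
   The lemmas *_factors (for the products) and finite_*_support (for the sums)
   at the end of the file show that the supports are always finite, provided
   that s * u != 1 in the case of the functions sHL. *)

Definition is_intpart (l : seq nat) : bool := sorted geq l && (0 \notin l)%N.

Record intpart := IntPart { parts :> seq nat; _ : is_intpart parts }.

HB.instance Definition _ := [isSub for parts].
HB.instance Definition _ := [Countable of intpart by <:].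

Definition conj_seq (l : seq nat) : seq nat :=
  mkseq (fun i => count (fun p => (i < p)%N) l) (head 0%N l).

Lemma conj_seqP (la : intpart) : is_intpart (conj_seq la).
Proof.
apply/andP; split.
  apply: (@homo_sorted _ _ _ leq); last exact: iota_sorted.
  by move=> i j ij; apply: sub_count => p; apply: leq_ltn_trans.
rewrite /conj_seq /mkseq; apply/negP; case/mapP=> i; rewrite mem_iota add0n => /andP[_].
by case: (parts la) => //= a l ->.
Qed.

Definition conjp (la : intpart) : intpart := IntPart (conj_seqP la).

(* [mult la c] is m_{c+1}(la), and [dmult la c] is la_{c+1} - la_{c+2}. *)
Definition mult (la : intpart) (c : nat) : nat := count_mem c.+1 la.
Definition dmult (la : intpart) (c : nat) : nat :=
  (nth 0 la c - nth 0 la c.+1)%N.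

Definition eventually_is (T : Type) (z : T) (f : nat -> T) : Prop :=
  exists N, forall c, (N <= c)%N -> f c = z.

Section Functions.
Variable K : fieldType.
Variables q s : K.

(* (a;q)_m *)
Definition qpoch (a : K) (m : nat) : K := \prod_(i < m) (1 - a * q ^+ i).

(* x^l (-s/x;q)_l, extended to x = 0 *)
Definition xpoch (x : K) (l : nat) : K := \prod_(r < l) (x + s * q ^+ r).

Definition Wt (x : K) (i j k l : nat) : K :=
  if (i + j == k + l)%N && (l <= i)%N then
    xpoch x l * qpoch (- s * x) (i - l) * qpoch q k
    / (qpoch q l * qpoch q (i - l) * qpoch (s ^+ 2) k)
  else 0.

(* A configuration is a pair (h, v) where [h r c] is h_{r+1,c} and [v r c] is
   v_{r,c+1}.  Requiring each v_r to vanish eventually loses nothing: a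
   configuration without this property violates i + j = k + l at some vertex. *)
Definition qW_config (n : nat) : Type :=
  (('I_n -> nat -> nat) * ('I_n.+1 -> nat -> nat))%type.

Definition qW_configs (n : nat) (la mu : intpart) : set (qW_config n) :=
  [set hv | [/\ forall r, eventually_is 0%N (hv.1 r),
                forall r, eventually_is 0%N (hv.2 r),
                hv.2 ord0 = dmult mu
              & hv.2 ord_max = dmult la]].

(* [lift ord_max r] and [lift ord0 r] have values r and r + 1. *)
Definition qW_row (n : nat) (x : 'I_n -> K) (hv : qW_config n) (r : 'I_n) : K :=
  xpoch (x r) (hv.1 r 0%N) / qpoch q (hv.1 r 0%N) *
  \big[*%R/1]_(c \in [set: nat])
     Wt (x r) (hv.2 (lift ord_max r) c) (hv.1 r c)
              (hv.2 (lift ord0 r) c) (hv.1 r c.+1).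

Definition qW (n : nat) (la mu : intpart) (x : 'I_n -> K) : K :=
  \sum_(hv \in @qW_configs n la mu) \prod_(r < n) qW_row x hv r.

Definition ctilde (la : intpart) : K :=
  \big[*%R/1]_(c \in [set: nat])
    (qpoch (s ^+ 2) (mult la c) / qpoch q (mult la c)).

Definition qW_dual (n : nat) (la mu : intpart) (x : 'I_n -> K) : K :=
  ctilde (conjp la) / ctilde (conjp mu) * qW la mu x.

Definition wt (u : K) (i : nat) (j : bool) (k : nat) (l : bool) : K :=
  if (i + j == k + l)%N then
    match j, l with
    | false, false => (1 - s * q ^+ i * u) / (1 - s * u)
    | false, true => (1 - s ^+ 2 * q ^+ k) * u / (1 - s * u)
    | true, false => (1 - q ^+ k) / (1 - s * u)
    | true, true => (u - s * q ^+ i) / (1 - s * u)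
    end
  else 0.

Definition Ct_term (u : K) (mu la : intpart) (h : nat -> bool) : K :=
  u ^+ h 0%N *
  \big[*%R/1]_(c \in [set: nat]) wt u (mult mu c) (h c) (mult la c) (h c.+1).

(* <<mu| C~(u) |la>> *)
Definition Ct (u : K) (mu la : intpart) : K :=
  \sum_(h \in [set h : nat -> bool | eventually_is false h]) Ct_term u mu la h.

Definition chains (m : nat) (mu la : intpart) : set ('I_m.+1 -> intpart) :=
  [set ch | ch ord0 = mu /\ ch ord_max = la].

Definition chain_term (m : nat) (u : 'I_m -> K) (ch : 'I_m.+1 -> intpart) : K :=
  \prod_(r < m) Ct (u r) (ch (lift ord_max r)) (ch (lift ord0 r)).

Definition sHL (m : nat) (la mu : intpart) (u : 'I_m -> K) : K :=
  \sum_(ch \in @chains m mu la) chain_term u ch.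

End Functions.

Lemma finite_ffun (I : finType) (T : choiceType) (A : set T) :
  finite_set A -> finite_set [set f : I -> T | forall i, A (f i)].
Proof.
move=> /finite_seqP[l ->].
have := @finite_image _ _ [set: {ffun I -> seq_sub l}] (fun g i => val (g i))
  finite_finset.
apply: sub_finite_set => f /= fA; exists [ffun i => SeqSub (fA i)] => //.
by apply/funext => i; rewrite ffunE.
Qed.

Lemma finite_bnd (N B : nat) :
  finite_set [set f : nat -> nat |
    forall c, (f c <= B)%N /\ ((N <= c)%N -> f c = 0%N)].
Proof.
have Afin : finite_set [set k : nat | (k <= B)%N].
  by apply: (sub_finite_set _ (finite_II B.+1)) => k /=.
have := finite_image (fun g : 'I_N -> nat => fun c => oapp g 0%N (insub c))
  (finite_ffun 'I_N Afin).
apply: sub_finite_set => f /= fP; exists (fun i : 'I_N => f i) => [i|]; first by case: (fP i).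
apply/funext => c; case: insubP => [i _ <- //|]; rewrite -leqNgt => Nc.
by case: (fP c) => _ ->.
Qed.

Lemma finite_intpart (L B : nat) :
  finite_set [set la : intpart | (size la <= L)%N /\ (head 0%N la <= B)%N].
Proof.
apply: (@sub_finite_set _ _ ((fun la : intpart => nth 0%N la) @^-1`
    [set f : nat -> nat | forall c, (f c <= B)%N /\ ((L <= c)%N -> f c = 0%N)])).
  move=> la [sL hB] c; split; last by move=> Lc; rewrite nth_default// (leq_trans sL).
  have /andP[so _] : is_intpart la := valP la.
  have [lc|lc] := leqP (size la) c; first by rewrite nth_default.
  apply: leq_trans hB; rewrite -nth0.
  apply: (sorted_leq_nth _ _ _ so) => //.
  - by move=> x y z; rewrite /geq /= => yx zy; apply: leq_trans zy yx.
  - by move=> x; rewrite /geq /=.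
  - by rewrite inE (leq_ltn_trans _ lc).
apply: (finite_preimage _ (finite_bnd L B)) => la mu _ _ E; apply: val_inj; apply: (@eq_from_nth _ 0%N) => /=; last first.
  by move=> i _; rewrite [LHS](congr1 (fun f => f i) E).
have nz (ka : intpart) i : (i < size ka)%N = (nth 0%N ka i != 0%N).
  have /andP[_ n0] : is_intpart ka := valP ka.
  have [ik|ik] := ltnP; last by rewrite nth_default.
  by apply/esym; apply: contra n0 => /eqP <-; rewrite mem_nth.
apply/eqP; rewrite eqn_leq; apply/andP; split; rewrite leqNgt nz.
- by rewrite E nth_default.
- by rewrite -E nth_default.
Qed.

Lemma ord_ind_up (m : nat) (P : 'I_m.+1 -> Prop) : P ord0 ->
  (forall r : 'I_m, P (lift ord_max r) -> P (lift ord0 r)) -> forall r, P r.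
Proof.
move=> P0 PS [r]; elim: r => [|r IH] rm; first by congr (P _): P0; apply: val_inj.
have := PS (Ordinal (rm : (r < m)%N)); have rm' := ltnW rm.
have -> : lift ord_max (Ordinal (rm : (r < m)%N)) = Ordinal rm'.
  by apply: val_inj; rewrite /= /bump; lia.
by move=> /(_ (IH rm')); congr P; apply: val_inj; rewrite /= /bump.
Qed.

Lemma ord_ind_down (m : nat) (P : 'I_m.+1 -> Prop) : P ord_max ->
  (forall r : 'I_m, P (lift ord0 r) -> P (lift ord_max r)) -> forall r, P r.
Proof.
move=> Pm PS r; rewrite -(rev_ordK r); move: (rev_ord r).
apply: ord_ind_up => [|k Pk].
  by rewrite (_ : rev_ord _ = ord_max)//; apply: val_inj; rewrite /= subn1.
have := PS (rev_ord k); rewrite (_ : lift ord0 (rev_ord k) = rev_ord (lift ord_max k)).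
  move=> /(_ Pk); rewrite (_ : lift ord_max (rev_ord k) = rev_ord (lift ord0 k))//.
  by apply: val_inj; rewrite /= /bump; have := ltn_ord k; lia.
by apply: val_inj; rewrite /= /bump; have := ltn_ord k; lia.
Qed.

Lemma parts_gt0 (la : intpart) p : p \in parts la -> (0 < p)%N.
Proof.
have /andP[_ n0] : is_intpart la := valP la.
by case: p => // p0; rewrite p0 in n0.
Qed.

Lemma parts_le_head (la : intpart) p : p \in parts la -> (p <= head 0 la)%N.
Proof.
have /andP[so _] : is_intpart la := valP la.
case: (parts la) so => //= a l; rewrite (path_sortedE (leT := geq)); last first.
  by move=> x y z; rewrite /geq /= => yx zy; apply: leq_trans zy yx.
by move=> /andP[/allP al _]; rewrite inE => /predU1P[->//|/al].
Qed.

Lemma mult0 (la : intpart) c : (head 0 la <= c)%N -> mult la c = 0%N.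
Proof.
by move=> hc; apply/count_memPn; apply: contraTN hc => /parts_le_head; rewrite -ltnNge.
Qed.

Lemma dmult0 (la : intpart) c : (size la <= c)%N -> dmult la c = 0%N.
Proof. by move=> hc; rewrite /dmult nth_default. Qed.

Lemma sum_mult (la : intpart) N : (head 0 la <= N)%N ->
  (\sum_(c < N) mult la c = size la)%N.
Proof.
move=> hN.
have multE c : mult la c = (\sum_(p <- parts la) (p == c.+1))%N.
  by rewrite /mult; elim: (parts la) => [|p l /= ->]; rewrite ?big_nil ?big_cons.
rewrite (eq_bigr _ (fun (c : 'I_N) _ => multE c)) exchange_big /= -sum1_size !big_seq; apply: eq_bigr => p pla.
have p0 := parts_gt0 pla; have pN := leq_trans (parts_le_head pla) hN.
have pN' : (p.-1 < N)%N by lia.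
rewrite (bigD1 (Ordinal pN')) //= prednK// eqxx big1 ?addn0// => i /eqP iN.
by case: eqP => // pi; case: iN; apply: val_inj; rewrite /= pi.
Qed.

Lemma telescope_row (v v' h : nat -> nat) N :
    (forall c, v c + h c = v' c + h c.+1)%N ->
  (\sum_(c < N) v c + h 0 = \sum_(c < N) v' c + h N)%N.
Proof.
move=> cons; elim: N => [|N IH]; first by rewrite !big_ord0.
rewrite !big_ord_recr /= addnAC IH -addnA [(h N + _)%N]addnC cons addnA.
by [].
Qed.

Section Rows.
Variables (n : nat) (h : 'I_n -> nat -> nat) (v : 'I_n.+1 -> nat -> nat).
Hypothesis rows : forall r c,
  (v (lift ord_max r) c + h r c = v (lift ord0 r) c + h r c.+1)%N /\
  (h r c.+1 <= v (lift ord_max r) c)%N.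

Lemma rows_bounded N B : (forall c, (N <= c)%N -> v ord_max c = 0%N) ->
    (\sum_(c < N) v ord_max c <= B)%N ->
  (forall r c, (h r c <= B)%N /\ ((N <= c)%N -> h r c = 0%N)) /\
  (forall r c, (v r c <= B)%N /\ ((N <= c)%N -> v r c = 0%N)).
Proof.
move=> vm0 vmB.
have tel r := telescope_row N (fun c => (rows r c).1).
have step (r : 'I_n) : (forall c, (N <= c)%N -> v (lift ord0 r) c = 0%N) ->
    forall c, (N <= c)%N -> h r c = 0%N.
  by move=> v0 c Nc; have [] := rows r c; rewrite v0// ; lia.
have vP r : (forall c, (N <= c)%N -> v r c = 0%N) /\ (\sum_(c < N) v r c <= B)%N.
  move: r; apply: ord_ind_down => [//|r [v0 vB]]; split=> [c Nc|].
    by have [+ _] := rows r c; rewrite v0// !(step r v0) ?(leq_trans Nc)// ; lia.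
  by apply: leq_trans vB; have := tel r; rewrite (step r v0 N)// addn0 => <-; exact: leq_addr.
have vB r c : (v r c <= B)%N.
  have [v0 vB] := vP r; have [Nc|cN] := leqP N c; first by rewrite v0.
  by apply: leq_trans vB; rewrite (bigD1 (Ordinal cN))//= leq_addr.
have h0 r := step r (vP _).1.
split=> r c; split=> //; [|exact: h0|exact: (vP r).1].
case: c => [|c]; last by apply: leq_trans (rows r c).2 _.
apply: leq_trans (vP (lift ord0 r)).2.
by have := tel r; rewrite (h0 r N)// addn0 => <-; exact: leq_addl.
Qed.

Lemma rows_length N : (forall c, (N <= c)%N -> v ord0 c = 0%N) ->
  forall c, (N + n <= c)%N -> v ord_max c = 0%N.
Proof.
move=> v0.
have vP (r : 'I_n.+1) : forall c, (N + r <= c)%N -> v r c = 0%N.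
  move: r; apply: ord_ind_up => [c|r IH [|c]]; first by rewrite addn0 => /v0.
    by rewrite /= /bump /=; lia.
  have rE : lift ord_max r = r :> nat by exact: lift_max.
  rewrite rE in IH; rewrite /= /bump /= add1n addnS ltnS => cr.
  have [+ _] := rows r c.+1; have [_ +] := rows r c.
  by rewrite !IH ?(leq_trans cr)// ; lia.
exact: (vP ord_max).
Qed.

End Rows.

Lemma size_conjp (la : intpart) : size (conjp la) = head 0%N la.
Proof. by rewrite size_mkseq. Qed.

Section FiniteSupports.
Variable K : fieldType.
Variables q s : K.

Lemma finite_prod_support (f : nat -> K) : eventually_is 1 f ->
  finite_set ([set: nat] `&` f @^-1` [set~ 1]).
Proof.
move=> [N fN]; apply: (sub_finite_set _ (finite_II N)) => k [_] /=.
by move=> /eqP fk; rewrite ltnNge; apply: contraNN fk => /fN ->.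
Qed.

Lemma fsprod_neq0 (f : nat -> K) : eventually_is 1 f ->
  \big[*%R/1]_(c \in [set: nat]) f c != 0 -> forall c, f c != 0.
Proof.
move=> ef; set S := finite_support _ _ _ => P0 c; apply: contraNneq P0 => fc.
have cS : c \in S.
  rewrite in_finite_support ?inE /=; last exact: finite_prod_support.
  by split=> //; rewrite fc; apply/eqP; rewrite eq_sym oner_eq0.
by rewrite (big_rem c) //= fc mul0r.
Qed.

Lemma fssum_neq0 (T : choiceType) (A : set T) (f : T -> K) :
  \sum_(i \in A) f i != 0 -> exists2 i, A i & f i != 0.
Proof.
move=> S0; apply: contrapT => nA; case/eqP: S0; apply: fsbig1 => i Ai.
by apply/eqP; apply: contrapT => /negP fi; apply: nA; exists i.
Qed.

Lemma ctilde_factors (la : intpart) :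
  eventually_is 1 (fun c => qpoch q (s ^+ 2) (mult la c) / qpoch q q (mult la c)).
Proof.
exists (head 0%N la) => c /mult0 ->.
by rewrite /qpoch !big_ord0 divr1.
Qed.

Lemma wt_factors (u : K) (mu la : intpart) (h : nat -> bool) :
    s * u != 1 -> eventually_is false h ->
  eventually_is 1 (fun c => wt q s u (mult mu c) (h c) (mult la c) (h c.+1)).
Proof.
move=> su [N hN]; exists (maxn N (maxn (head 0%N mu) (head 0%N la))) => c.
rewrite !geq_max => /and3P[Nc /mult0 -> /mult0 ->].
rewrite !hN ?(leq_trans Nc)// /wt /= expr0 mulr1 divff//.
by rewrite subr_eq0 eq_sym.
Qed.

Lemma Wt_factors (n : nat) (la mu : intpart) (x : 'I_n -> K) hv r :
    @qW_configs n la mu hv ->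
  eventually_is 1 (fun c => Wt q s (x r)
    (hv.2 (lift ord_max r) c) (hv.1 r c) (hv.2 (lift ord0 r) c) (hv.1 r c.+1)).
Proof.
move=> [eh ev _ _]; have [N1 h1] := eh r.
have [N2 h2] := ev (lift ord_max r); have [N3 h3] := ev (lift ord0 r).
exists (maxn N1 (maxn N2 N3)) => c; rewrite !geq_max => /and3P[c1 c2 c3].
rewrite h1// h2// h3// h1 ?(leq_trans c1)// /Wt /= /xpoch /qpoch !big_ord0.
by rewrite !mulr1 divr1.
Qed.

Lemma Ct_term_conserve (u : K) (mu la : intpart) (h : nat -> bool) :
    s * u != 1 -> eventually_is false h -> Ct_term q s u mu la h != 0 ->
  forall c, (mult mu c + h c = mult la c + h c.+1)%N.
Proof.
move=> su eh; rewrite mulf_eq0 negb_or => /andP[_ t0] c.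
have := fsprod_neq0 (wt_factors mu la su eh) t0 c.
by rewrite /wt; case: ifP => [/eqP //|_]; rewrite eqxx.
Qed.

Lemma Ct_term_vanish (u : K) (mu la : intpart) (h : nat -> bool) :
    s * u != 1 -> eventually_is false h -> Ct_term q s u mu la h != 0 ->
  forall c, (maxn (head 0 mu) (head 0 la) <= c)%N -> h c = false.
Proof.
move=> su eh t0 c cN; have [N hN] := eh.
have cst k : h c = h (c + k)%N.
  elim: k => [|k ->]; first by rewrite addn0.
  have := Ct_term_conserve su eh t0 (c + k).
  move: cN; rewrite geq_max => /andP[c1 c2].
  rewrite !mult0 ?(leq_trans c1) ?(leq_trans c2) ?leq_addr// addnS.
  by case: (h _); case: (h _).
by rewrite (cst N) hN// leq_addl.
Qed.

Lemma finite_Ct_support (u : K) (mu la : intpart) : s * u != 1 ->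
  finite_set ([set h | eventually_is false h]
    `&` Ct_term q s u mu la @^-1` [set~ 0]).
Proof.
move=> su; pose N := maxn (head 0%N mu) (head 0%N la).
apply: (@sub_finite_set _ _ ((fun h : nat -> bool => fun c => nat_of_bool (h c))
  @^-1` [set f : nat -> nat |
         forall c, (f c <= 1)%N /\ ((N <= c)%N -> f c = 0%N)])).
  move=> h [/= eh /eqP t0] c; split; first by case: (h c).
  by move=> Nc; rewrite (Ct_term_vanish su eh t0).
apply: (finite_preimage _ (finite_bnd N 1)) => h h' _ _ E.
by apply/funext => c; have := congr1 (@^~ c) E; case: (h c); case: (h' c).
Qed.

Lemma Ct_neq0 (u : K) (mu la : intpart) : s * u != 1 -> Ct q s u mu la != 0 ->
  [/\ (size mu <= size la)%N, (head 0 mu <= head 0 la)%N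
    & (size la <= (size mu).+1)%N].
Proof.
move=> su /fssum_neq0[h eh t0].
have cons := Ct_term_conserve su eh t0; have van := Ct_term_vanish su eh t0.
set N := maxn _ _ in van.
have := telescope_row N cons.
rewrite !sum_mult ?leq_maxl ?leq_maxr// (van N)//= addn0 => E.
split; [by lia| |by move: E; case: (h 0%N) => /=; lia].
rewrite leqNgt; apply/negP => lt.
have := cons (head 0%N mu).-1; rewrite prednK; last by lia.
rewrite (van (head 0%N mu)) ?geq_max ?leqnn ?(ltnW lt)//.
rewrite [mult la _]mult0; last by lia.
rewrite /= addn0 => /eqP; rewrite addn_eq0 => /andP[/eqP/count_memPn + _].
rewrite prednK; last by lia.
by case: (parts mu) lt => //= a l _; rewrite inE eqxx.
Qed.

Lemma chain_term_neq0 (m : nat) (u : 'I_m -> K) (ch : 'I_m.+1 -> intpart) :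
    (forall i, s * u i != 1) -> chain_term q s u ch != 0 ->
  forall r, [/\ (size (ch r) <= size (ch ord_max))%N,
    (head 0 (ch r) <= head 0 (ch ord_max))%N
    & (size (ch r) <= size (ch ord0) + r)%N].
Proof.
move=> su /prodf_neq0 t0 r.
have {}t0 i := Ct_neq0 (su i) (t0 i isT).
have [a b] : (size (ch r) <= size (ch ord_max))%N /\
    (head 0 (ch r) <= head 0 (ch ord_max))%N.
  move: r; apply: ord_ind_down => // r [a b]; have [c d _] := t0 r.
  by split; [exact: leq_trans a|exact: leq_trans b].
split=> //; move: r {a b}; apply: ord_ind_up => [|r IH]; first by rewrite addn0.
have [_ _ c] := t0 r; apply: (leq_trans c).
by move: IH; rewrite lift_max /= /bump /=; lia.
Qed.

Lemma finite_sHL_support (m : nat) (la mu : intpart) (u : 'I_m -> K) :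
    (forall i, s * u i != 1) ->
  finite_set (@chains m mu la `&` chain_term q s u @^-1` [set~ 0]).
Proof.
move=> su; have := finite_ffun 'I_m.+1 (finite_intpart (size la) (head 0%N la)).
apply: sub_finite_set => ch [[_ cl] /eqP t0] r /=.
by have [a b _] := chain_term_neq0 su t0 r; rewrite -cl.
Qed.

Lemma sHL_neq0 (m : nat) (la mu : intpart) (u : 'I_m -> K) :
    (forall i, s * u i != 1) -> sHL q s la mu u != 0 ->
  [/\ (size mu <= size la)%N, (head 0 mu <= head 0 la)%N
    & (size la <= size mu + m)%N].
Proof.
move=> su /fssum_neq0[ch [c0 cm] t0].
have [a b _] := chain_term_neq0 su t0 ord0.
have [_ _ c] := chain_term_neq0 su t0 ord_max.
by rewrite -c0 -cm.
Qed.

Lemma qW_term_conserve (n : nat) (la mu : intpart) (x : 'I_n -> K) hv :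
    @qW_configs n la mu hv -> \prod_(r < n) qW_row q s x hv r != 0 ->
  forall r c, (hv.2 (lift ord_max r) c + hv.1 r c =
               hv.2 (lift ord0 r) c + hv.1 r c.+1)%N /\
              (hv.1 r c.+1 <= hv.2 (lift ord_max r) c)%N.
Proof.
move=> chv /prodf_neq0 t0 r c; have := t0 r isT.
rewrite mulf_eq0 negb_or => /andP[_ {}t0].
have := fsprod_neq0 (Wt_factors x r chv) t0 c.
by rewrite /Wt; case: ifP => [/andP[/eqP -> ->]//|_]; rewrite eqxx.
Qed.

Lemma finite_qW_support (n : nat) (la mu : intpart) (x : 'I_n -> K) :
  finite_set (@qW_configs n la mu
    `&` (fun hv => \prod_(r < n) qW_row q s x hv r) @^-1` [set~ 0]).
Proof.
pose N := size la; pose B := (\sum_(c < N) dmult la c)%N.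
have fin (k : nat) := finite_ffun 'I_k (finite_bnd N B).
have := finite_setX (fin n) (fin n.+1).
apply: sub_finite_set => -[h v] [chv /eqP t0].
have rows := qW_term_conserve chv t0; case: chv => _ _ _ /= vm.
have vm0 c : (N <= c)%N -> v ord_max c = 0%N by rewrite vm; exact: dmult0.
have vmB : (\sum_(c < N) v ord_max c <= B)%N by rewrite vm.
by have := rows_bounded rows vm0 vmB.
Qed.

Lemma qW_neq0 (n : nat) (la mu : intpart) (x : 'I_n -> K) :
  qW q s la mu x != 0 -> (size la <= size mu + n)%N.
Proof.
move=> /fssum_neq0[[h v] chv t0].
have rows := qW_term_conserve chv t0; case: chv => _ _ /= v0 vm.
have v00 c : (size mu <= c)%N -> v ord0 c = 0%N by rewrite v0; exact: dmult0.
have := rows_length rows v00; rewrite /= vm => vP.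
rewrite leqNgt; apply/negP => lt.
have sz : (0 < size la)%N by lia.
have := vP (size la).-1; rewrite /dmult prednK//.
rewrite [nth _ _ (size la)]nth_default// subn0 => E.
have : nth 0%N la (size la).-1 \in parts la by rewrite mem_nth// ltn_predL.
by move=> /parts_gt0; rewrite E// -ltnS prednK.
Qed.

Lemma finite_lhs_support (m n : nat) (mu nu : intpart)
    (u : 'I_m -> K) (x : 'I_n -> K) : (forall i, s * u i != 1) ->
  finite_set ([set: intpart] `&` (fun la =>
    sHL q s la mu u * qW_dual q s (conjp la) (conjp nu) x) @^-1` [set~ 0]).
Proof.
move=> su; have := finite_intpart (size mu + m) (head 0 nu + n)%N.
apply: sub_finite_set => la [_ /eqP] /=; rewrite !mulf_eq0 !negb_or.
move=> /and3P[/(sHL_neq0 su)[_ _ ->] _ /qW_neq0].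
by rewrite !size_conjp.
Qed.

Lemma finite_rhs_support (m n : nat) (mu nu : intpart)
    (u : 'I_m -> K) (x : 'I_n -> K) : (forall i, s * u i != 1) ->
  finite_set ([set: intpart] `&` (fun ka =>
    sHL q s nu ka u * qW_dual q s (conjp mu) (conjp ka) x) @^-1` [set~ 0]).
Proof.
move=> su; have := finite_intpart (size nu) (head 0 nu)%N.
apply: sub_finite_set => ka [_ /eqP] /=; rewrite mulf_eq0 negb_or.
by move=> /andP[/(sHL_neq0 su)[-> -> _]].
Qed.

End FiniteSupports.

(* Main.v *)
(* In terms of the column lengths a_c of the partitions, both families are partition
   functions of lattice models whose horizontal edges are determined by the vertical
   ones: h_c = b_c - a_c for a row going from the partition a to the partition b.
   Hence sHL and qW_dual are matrix elements of products of one-variable operators,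
   and the theorem reduces to the case m = n = 1 by commuting these operators one by
   one.  For m = n = 1 both sides, for fixed outer partitions a and c, are sums over
   h in {0,1}^N of products of 2 x 2 matrices, M_i(h_i,h_{i+1}) on the left and
   N_i(g_i,g_{i+1}) on the right.  A Yang-Baxter equation M_i X_{i+1} = X_i N_i, with
   X_i depending only on a_i - c_i, carries one sum to the other: the left boundary
   vector is an eigenvector of X_0 with eigenvalue (1 + ux)/(1 - su), and the right
   boundary vector of the first sum is the image under X_N of that of the second. *)
Require Import Defs.
From HB Require Import structures.
From mathcomp Require Import all_boot all_order all_algebra.
From mathcomp Require Import boolp classical_sets cardinality fsbigop.
From mathcomp Require Import reals complex.
From mathcomp Require Import zify ring.

Set Implicit Arguments.
Unset Strict Implicit.
Unset Printing Implicit Defensive.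

Import Order.TTheory GRing.Theory Num.Theory.

Local Open Scope classical_set_scope.
Local Open Scope ring_scope.

(** * The Yang-Baxter equation *)

Section Exchange.
Variables (K : fieldType) (q s u x : K).
Hypothesis q_neq1 : forall k, 1 - q ^+ k.+1 != 0.
Hypothesis s2_neq1 : forall k, 1 - s ^+ 2 * q ^+ k != 0.
Hypothesis su_neq1 : 1 - s * u != 0.

Lemma qpoch_recr (a : K) m : qpoch q a m.+1 = qpoch q a m * (1 - a * q ^+ m).
Proof. by rewrite /qpoch big_ord_recr. Qed.

Lemma xpoch_recr m : xpoch q s x m.+1 = xpoch q s x m * (x + s * q ^+ m).
Proof. by rewrite /xpoch big_ord_recr. Qed.

Lemma qpochq_neq0 m : qpoch q q m != 0.
Proof. by apply/prodf_neq0 => i _; rewrite -exprS. Qed.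

Lemma qpochs_neq0 m : qpoch q (s ^+ 2) m != 0.
Proof. by apply/prodf_neq0. Qed.

(* [Wt x i _ k l] times the ratio of the factors of [ctilde] at k and at i, which
   no longer depends on k; here r stands for i - l. *)
Definition Wd (i l r : nat) : K :=
  xpoch q s x l * qpoch q (- s * x) r * qpoch q q i
  / (qpoch q q l * qpoch q q r * qpoch q (s ^+ 2) i).

(* Joint weight of column i of the two rows a -> b and c -> b (for [colM]) or b -> a
   and b -> c (for [colN]), where a, a' and c, c' are the values of a and c at i and
   i + 1, and where b_i = a_i + h_i, respectively b_i = c_i - g_i.  In [colN],
   the b's are not truncated: b_i - b_{i+1} is written c + g' - (c' + g), and b_{i+1}
   may be -1, without which [exchange] would fail for c' = 0. *)
Definition colM (a a' c c' : nat) (h h' : bool) : K :=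
  if (c' <= a' + h' <= c)%N then
    wt q s u (a - a') h (a + h - (a' + h')) h' *
    Wd (c - c') (a' + h' - c') (c - (a' + h'))
  else 0.

Definition colN (a a' c c' : nat) (g g' : bool) : K :=
  if (c' <= a' + g')%N && (a' + g <= c)%N then
    wt q s u (c + g' - (c' + g)) g (c - c') g' *
    Wd (c + g' - (c' + g)) (a' + g' - c') (c - (a' + g))
  else 0.

(* The matrix X_i of the Yang-Baxter equation, with k = a_i + h - c_i. *)
Definition Rmx (h g : bool) (k : nat) : K :=
  match h, g with
  | false, false => 1 - u * s * q ^+ k
  | false, true => u * (x + s * q ^+ k)
  | true, false => 1 - q ^+ k
  | true, true => u * x + q ^+ k
  end / (1 - s * u).

(** Parametrizing by nonnegative gaps removes every truncated subtraction, so that [field] later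
    meets only sums in exponents. *)
Lemma colME p k i l r a a' c c' (h h' : bool) :
  a = (a' + p)%N -> (p + h = k + h')%N -> c = (c' + i)%N ->
  (a' + h' = c' + l)%N -> i = (l + r)%N ->
  colM a a' c c' h h' = wt q s u p h k h' * Wd i l r.
Proof.
move=> -> E -> E' ->; rewrite /colM E' ifT; last by lia.
by congr (wt _ _ _ _ _ _ _ * Wd _ _ _); lia.
Qed.

Lemma colNE p k l r a a' c c' (g g' : bool) :
  c = (c' + k)%N -> (p + g = k + g')%N ->
  (a' + g' = c' + l)%N -> (c = a' + g + r)%N ->
  colN a a' c c' g g' = wt q s u p g k g' * Wd p l r.
Proof.
move=> -> E E' E2; rewrite /colN E' ifT; last by lia.
by congr (wt _ _ _ _ _ _ _ * Wd _ _ _); lia.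
Qed.

Lemma colM0 a a' c c' (h h' : bool) :
  (a' + h' < c')%N || (c < a' + h')%N -> colM a a' c c' h h' = 0.
Proof. by move=> E; rewrite /colM ifF //; lia. Qed.

Lemma colN0 a a' c c' (g g' : bool) :
  (a' + g' < c')%N || (c < a' + g)%N -> colN a a' c c' g g' = 0.
Proof. by move=> E; rewrite /colN ifF //; lia. Qed.

Lemma wt00 i : wt q s u i false i false = (1 - s * q ^+ i * u) / (1 - s * u).
Proof. by rewrite /wt eqxx. Qed.
Lemma wt01 i : wt q s u i.+1 false i true = (1 - s ^+ 2 * q ^+ i) * u / (1 - s * u).
Proof. by rewrite /wt addn0 addn1 eqxx. Qed.
Lemma wt10 i : wt q s u i true i.+1 false = (1 - q ^+ i.+1) / (1 - s * u).
Proof. by rewrite /wt addn0 addn1 eqxx. Qed.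
Lemma wt11 i : wt q s u i true i true = (u - s * q ^+ i) / (1 - s * u).
Proof. by rewrite /wt eqxx. Qed.

Lemma qpochq_factor k : 1 - q * q ^+ k != 0.
Proof. by rewrite -exprS. Qed.

Ltac exch_eval :=
  rewrite ?(addn0, addn1, addnS, addSn, subn0) ?(wt00, wt10, wt11, wt01) /Wd /Rmx
    ?(xpoch_recr, qpoch_recr) ?expr2 ?(exprD, exprS, expr0).
Ltac exch_field := field; do ?[apply/andP; split] => //.

(** The gaps e, f, d are those of c' <= a' <= c <= a. In these coordinates the Pochhammer symbols
    share common factors, and each choice of h and g' leaves a rational identity in powers of q. *)
Lemma exchange_ge_ge e f d c' (h g' : bool) :
  let: a' := (c' + e)%N in let: c := (a' + f)%N in let: a := (c + d)%N in
  \sum_(h' : bool) colM a a' c c' h h' * Rmx h' g' (e + h')%N =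
  \sum_(g : bool) Rmx h g (d + h)%N * colN a a' c c' g g'.
Proof.
(* If f = 0, then a' = c, and neither h' = 1 nor g = 1 fits below c. *)
rewrite !big_bool /=; case: f => [|f].
  rewrite (@colM0 _ _ _ _ h true) ?mul0r ?add0r; last by lia.
  rewrite (@colN0 _ _ _ _ true g') ?mulr0 ?add0r; last by lia.
  rewrite (@colME d (d + h)%N e e 0); try lia.
  rewrite (@colNE (e + g')%N e (e + g')%N 0); try lia.
  move: (qpochq_factor e) (s2_neq1 e) (qpochq_neq0 e) (qpochs_neq0 e) (qpochq_neq0 0).
  by case: h; case: g'; exch_eval => ? ? ? ? ?; exch_field.
rewrite (@colME (f.+1 + d)%N (f + d + h)%N (e + f.+1) e.+1 f _ _ _ _ h true); try lia.
rewrite (@colME (f.+1 + d)%N (f.+1 + d + h)%N (e + f.+1) e f.+1 _ _ _ _ h false); try lia.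
rewrite (@colNE (e + f + g')%N (e + f).+1 (e + g')%N f _ _ _ _ true); try lia.
rewrite (@colNE (e + f.+1 + g')%N (e + f).+1 (e + g')%N f.+1 _ _ _ _ false); try lia.
move: (qpochq_factor e) (qpochq_factor f) (qpochq_factor (e + f)) (qpochq_factor (e + f).+1)
  (s2_neq1 (e + f)) (s2_neq1 (e + f).+1)
  (qpochq_neq0 e) (qpochq_neq0 f) (qpochq_neq0 (e + f)) (qpochs_neq0 (e + f)).
by case: h; case: g'; exch_eval => *; exch_field.
Qed.

(* Here a + 1 = c, so that only h = 1 is admissible. *)
Lemma exchange_lt_ge e f c' (g' : bool) :
  let: a' := (c' + e)%N in let: c := (a' + f).+1 in let: a := (a' + f)%N in
  \sum_(h' : bool) colM a a' c c' true h' * Rmx h' g' (e + h')%N =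
  \sum_(g : bool) Rmx true g 0 * colN a a' c c' g g'.
Proof.
rewrite !big_bool /=.
rewrite (@colME f f (e + f).+1 e.+1 f _ _ _ _ true true); try lia.
rewrite (@colME f f.+1 (e + f).+1 e f.+1 _ _ _ _ true false); try lia.
rewrite (@colNE (e + f + g')%N (e + f).+1 (e + g')%N f _ _ _ _ true); try lia.
rewrite (@colNE (e + f.+1 + g')%N (e + f).+1 (e + g')%N f.+1 _ _ _ _ false); try lia.
move: (qpochq_factor e) (qpochq_factor f) (qpochq_factor (e + f)) (qpochq_factor (e + f).+1)
  (s2_neq1 (e + f)) (s2_neq1 (e + f).+1)
  (qpochq_neq0 e) (qpochq_neq0 f) (qpochq_neq0 (e + f)) (qpochs_neq0 (e + f)).
by case: g'; exch_eval => *; exch_field.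
Qed.

(** Since c' = a' + 1, only h' = 1 survives on the left. *)
Lemma exchange_ge_lt f d a' (h g' : bool) :
  let: c := (a' + f).+1 in let: a := (c + d)%N in
  colM a a' c a'.+1 h true * Rmx true g' 0 =
  \sum_(g : bool) Rmx h g (d + h)%N * colN a a' c a'.+1 g g'.
Proof.
rewrite !big_bool /=.
rewrite (@colME (f.+1 + d) (f + d + h) f 0 f _ _ _ _ h true); try lia.
(* For g' = 0 both [colN] vanish because a' < c', and the left side vanishes through the entry 1 -
   q^0 of [Rmx]. *)
case: g'; last first.
  rewrite (@colN0 _ _ _ _ true false); last by lia.
  rewrite (@colN0 _ _ _ _ false false); last by lia.
  by rewrite /Rmx expr0 subrr !mul0r !mulr0 addr0.
rewrite (@colNE f f 0 f _ _ _ _ true true); try lia.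
rewrite (@colNE f.+1 f 0 f.+1 _ _ _ _ false true); try lia.
move: (qpochq_factor f) (s2_neq1 f) (qpochq_neq0 0) (qpochq_neq0 f) (qpochs_neq0 f).
by case: h; exch_eval => *; exch_field.
Qed.

Lemma exchange_lt_lt f a' (g' : bool) :
  let: c := (a' + f).+1 in let: a := (a' + f)%N in
  colM a a' c a'.+1 true true * Rmx true g' 0 =
  \sum_(g : bool) Rmx true g 0 * colN a a' c a'.+1 g g'.
Proof.
rewrite !big_bool /=.
rewrite (@colME f f f 0 f _ _ _ _ true true); try lia.
case: g'; last first.
  rewrite (@colN0 _ _ _ _ true false); last by lia.
  rewrite (@colN0 _ _ _ _ false false); last by lia.
  by rewrite /Rmx expr0 subrr !mul0r !mulr0 addr0.
rewrite (@colNE f f 0 f _ _ _ _ true true); try lia.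
rewrite (@colNE f.+1 f 0 f.+1 _ _ _ _ false true); try lia.
move: (qpochq_factor f) (s2_neq1 f) (qpochq_neq0 0) (qpochq_neq0 f) (qpochs_neq0 f).
by exch_eval => *; exch_field.
Qed.

(** Nonzero weights require a' <= c and c' <= a' + 1, which leaves the four configurations above.
    The hypothesis c <= a + h makes [a + h - c] exact; wherever [a' + h' - c'] is truncated, [colM]
    vanishes. *)
Lemma exchange a a' c c' (h g' : bool) :
  (a' <= a)%N -> (c' <= c)%N -> (c <= a + h)%N ->
  \sum_(h' : bool) colM a a' c c' h h' * Rmx h' g' (a' + h' - c')%N =
  \sum_(g : bool) Rmx h g (a + h - c)%N * colN a a' c c' g g'.
Proof.
move=> a'a c'c cah.
have [ca'|a'c] := ltnP c a'.
  by rewrite !big_bool !colM0 ?colN0 ?(mul0r, mulr0) //; lia.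
have [a'c'|c'a'] := ltnP a' c'; last first.
  have [e a'E] : exists e, a' = (c' + e)%N by exists (a' - c')%N; lia.
  subst a'; under eq_bigr do rewrite -addnA addKn.
  have [ca|ac] := leqP c a.
    have [f cE] : exists f, c = (c' + e + f)%N by exists (c - (c' + e))%N; lia.
    have [d aE] : exists d, a = (c + d)%N by exists (a - c)%N; lia.
    by subst a c; under [RHS]eq_bigr do rewrite -addnA addKn; exact: exchange_ge_ge.
  case: h cah => cah; last by lia.
  have [f aE] : exists f, a = (c' + e + f)%N by exists (a - (c' + e))%N; lia.
  have cE : c = a.+1 by lia.
  by subst c a; under [RHS]eq_bigr do rewrite addn1 subnn; exact: exchange_lt_ge.
have [c'E|c'E] := eqVneq c' a'.+1; last first.
  by rewrite !big_bool !colM0 ?colN0 ?(mul0r, mulr0) //; lia.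
subst c'; rewrite big_bool /= addn1 subnn (@colM0 _ _ _ _ h false) ?mul0r ?addr0; last by lia.
have [f cE] : exists f, c = (a' + f).+1 by exists (c - a'.+1)%N; lia.
have [ca|ac] := leqP c a.
  have [d aE] : exists d, a = (c + d)%N by exists (a - c)%N; lia.
  by subst a c; under [RHS]eq_bigr do rewrite -addnA addKn; exact: exchange_ge_lt.
case: h cah => cah; last by lia.
have aE : a = (a' + f)%N by lia.
by subst c a; under [RHS]eq_bigr do rewrite addn1 subnn; exact: exchange_lt_lt.
Qed.

(** Left boundary weight: the factor u^h of [Ct_term] times the column-zero factor of [qW_row] with
    k entering paths. *)
Definition ell (k : nat) (h : bool) : K := u ^+ h * (xpoch q s x k / qpoch q q k).

Lemma ell_eigen a c (g : bool) :
  \sum_(h : bool) (if (c <= a + h)%N then ell (a + h - c) h else 0) * Rmx h g (a + h - c) =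
  (1 + u * x) / (1 - s * u) * (if (c <= a + g)%N then ell (a + g - c) g else 0).
Proof.
rewrite !big_bool; have [ca|ac] := leqP c a.
  have [d aE] : exists d, a = (c + d)%N by exists (a - c)%N; lia.
  rewrite !ifT; [|lia..]; rewrite {}aE -!addnA !addKn.
  move: (qpochq_factor d) (qpochq_neq0 d).
  by case: g; rewrite /ell /=; exch_eval => *; exch_field.
(* Only h = 1 can be admissible here, with c = a + 1, and its passage to g = 0 is killed by 1 - q^0
   = 0. *)
have -> : (c <= a + false)%N = false by lia.
rewrite /= mul0r addr0; have [->|cE] := eqVneq c a.+1; last by rewrite !ifF ?mul0r ?mulr0 //; lia.
rewrite addn1 leqnn subnn; case: g; rewrite ?addn0 ?addn1.
  by rewrite leqnn subnn mulrC /Rmx expr0 addrC.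
by rewrite ltnn /Rmx expr0 subrr mul0r !mulr0.
Qed.

(** A product of n transfer matrices from column i on, applied to the right boundary vector v. The
    recursive form serves the exchange argument; [path_weight], one term of its expansion, serves
    the comparison with partitions. *)
Fixpoint path_sum (W : nat -> bool -> bool -> K) (v : bool -> K) n i h : K :=
  if n is n'.+1 then \sum_(h' : bool) W i h h' * path_sum W v n' i.+1 h' else v h.

Definition path_weight (W : nat -> bool -> bool -> K) (v : bool -> K) n i (t : nat -> bool) : K :=
  \prod_(j < n) W (i + j)%N (t j) (t j.+1) * v (t n).

Lemma sum_tuple_cons (T : finType) n (F : n.+1.-tuple T -> K) :
  \sum_t F t = \sum_h \sum_(t : n.-tuple T) F [tuple of h :: t].
Proof.
rewrite pair_big /= (reindex (fun p : T * n.-tuple T => [tuple of p.1 :: p.2])) //.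
exists (fun t : n.+1.-tuple T => (thead t, [tuple of behead t])) => [[h t] _|t _].
  by congr (_, _); apply: val_inj.
by rewrite [RHS]tuple_eta.
Qed.

Lemma path_sumE W v n i h :
  path_sum W v n i h =
  \sum_(t : n.-tuple bool) path_weight W v n i (nth false (h :: t)).
Proof.
elim: n i h => [|n IH] i h /=.
  rewrite (eq_bigr (fun=> v h)) => [|t _]; last by rewrite /path_weight big_ord0 mul1r.
  by rewrite big_const card_tuple expn0 /= addr0.
rewrite sum_tuple_cons; apply: eq_bigr => h' _; rewrite IH mulr_sumr.
apply: eq_bigr => t _; rewrite /path_weight big_ord_recl addn0 mulrA; congr (_ * _ * _).
by apply: eq_bigr => j _; rewrite /= addSnnS.
Qed.

(** * Propagation of the exchange relation along a row *)

Section Paths.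
Variables a c : nat -> nat.
Hypothesis a_anti : forall i, (a i.+1 <= a i)%N.
Hypothesis c_anti : forall i, (c i.+1 <= c i)%N.

Let WM i := colM (a i) (a i.+1) (c i) (c i.+1).
Let WN i := colN (a i) (a i.+1) (c i) (c i.+1).
Let R (i : nat) h g := Rmx h g (a i + h - c i)%N.

Lemma path_exchange vM vN n i (h : bool) : (c i <= a i + h)%N ->
  (forall h : bool, vM h = \sum_(g : bool) R (i + n) h g * vN g) ->
  path_sum WM vM n i h = \sum_(g : bool) R i h g * path_sum WN vN n i g.
Proof.
elim: n i h => [|n IH] i h ch end_v /=; first by rewrite end_v addn0.
transitivity (\sum_(g' : bool) (\sum_(h' : bool) WM i h h' * R i.+1 h' g') *
    path_sum WN vN n i.+1 g').
  under [RHS]eq_bigr do rewrite mulr_suml.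
  rewrite exchange_big /=; apply: eq_bigr => h' _.
  (* The induction hypothesis needs admissibility at i + 1; a state h' violating it has [colM] equal
     to zero. *)
  have [ok|/negbTE nok] := boolP (c i.+1 <= a i.+1 + h')%N.
    rewrite IH // ?addSnnS // mulr_sumr; by apply: eq_bigr => g _; rewrite mulrA.
  rewrite /WM /colM nok /= mul0r big1 // => g _; by rewrite !mul0r.
transitivity (\sum_(g' : bool) (\sum_(g : bool) R i h g * WN i g g') *
    path_sum WN vN n i.+1 g').
  by apply: eq_bigr => g' _; congr (_ * _); exact: exchange.
under [LHS]eq_bigr do rewrite mulr_suml.
rewrite exchange_big /=; apply: eq_bigr => g _; rewrite mulr_sumr.
by apply: eq_bigr => g' _; rewrite mulrA.
Qed.

Let init (h : bool) : K := if (c 0 <= a 0 + h)%N then ell (a 0 + h - c 0) h else 0.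

(** Once X reaches column 0, [ell_eigen] turns it into the scalar. *)
Lemma tuple_exchange vM vN n :
  (forall h : bool, vM h = \sum_(g : bool) R n h g * vN g) ->
  \sum_(t : n.+1.-tuple bool) init (nth false t 0) * path_weight WM vM n 0 (nth false t) =
  (1 + u * x) / (1 - s * u) *
  \sum_(t : n.+1.-tuple bool) init (nth false t 0) * path_weight WN vN n 0 (nth false t).
Proof.
move=> end_v; rewrite !sum_tuple_cons /=.
under eq_bigr do rewrite -mulr_sumr -path_sumE.
under [in RHS]eq_bigr do rewrite -mulr_sumr -path_sumE.
rewrite mulr_sumr; under [in RHS]eq_bigr do rewrite mulrA -ell_eigen mulr_suml.
rewrite exchange_big /=; apply: eq_bigr => h _; rewrite /init; case: ifP => ch.
  by rewrite (path_exchange ch end_v) mulr_sumr; apply: eq_bigr => g _; rewrite mulrA.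
by rewrite mul0r big1 // => g _; rewrite !mul0r.
Qed.

End Paths.

End Exchange.

(** * Partitions and their column lengths *)

Definition clen (la : intpart) (c : nat) : nat := count (fun p => (c < p)%N) la.

Lemma clen_anti la c : (clen la c.+1 <= clen la c)%N.
Proof. by apply: sub_count => p /ltnW. Qed.

Lemma mult_clen la c : mult la c = (clen la c - clen la c.+1)%N.
Proof.
suff : (mult la c + clen la c.+1 = clen la c)%N by move=> <-; rewrite addnK.
by rewrite /mult /clen; elim: (parts la) => //= p l; lia.
Qed.

Lemma clen_eq0 (la : intpart) c : (head 0 la <= c)%N -> clen la c = 0%N.
Proof.
move=> hc; apply/eqP; rewrite -leqn0 leqNgt -has_count -all_predC.
by apply/allP => p /parts_le_head; rewrite /= -leqNgt => /leq_trans; apply.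
Qed.

Lemma nth_conjp la c : nth 0%N (conjp la) c = clen la c.
Proof.
have [cl|lc] := ltnP c (head 0%N la); first by rewrite /= /conj_seq nth_mkseq.
by rewrite nth_default ?size_conjp // clen_eq0.
Qed.

Lemma dmult_conjp la c : dmult (conjp la) c = mult la c.
Proof. by rewrite /dmult !nth_conjp mult_clen. Qed.

(** Both sides say that the cell in row c and column i lies in the Young diagram. *)
Lemma ltn_clen (la : intpart) c i : (c < clen la i)%N = (i < nth 0%N la c)%N.
Proof.
have /andP[+ _] : is_intpart la := valP la.
rewrite /clen; elim: (parts la) c => [|p l IH] c /=; first by rewrite nth_nil.
rewrite (path_sortedE (leT := geq)) => [/andP[/allP lep so]|]; last first.
  by move=> x y z; rewrite /geq /= => yx zy; apply: leq_trans zy yx.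
have [ip|pi] := ltnP i p; first by case: c => [|c] //=; rewrite add1n ltnS IH.
rewrite (_ : count _ l = 0%N); last first.
  apply/eqP; rewrite -leqn0 leqNgt -has_count -all_predC; apply/allP => z /lep.
  by rewrite /= -leqNgt => /leq_trans; apply.
apply/esym/negbTE; rewrite -leqNgt; case: c => [|c] //=.
have [cl|lc] := ltnP c (size l); last by rewrite nth_default.
by apply: leq_trans pi; apply: lep; rewrite mem_nth.
Qed.

Lemma size_clen (la : intpart) : size la = clen la 0.
Proof.
apply/esym/eqP; rewrite /clen -all_count; apply/allP => p; exact: parts_gt0.
Qed.

Lemma head_clen (la : intpart) c : (head 0 la <= c)%N = (clen la c == 0)%N.
Proof. by rewrite leqNgt -nth0 -ltn_clen lt0n negbK. Qed.

Lemma clen_conjp (la : intpart) c : clen (conjp la) c = nth 0%N la c.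
Proof.
rewrite {1}/clen /= /conj_seq /mkseq count_map.
rewrite (@eq_count _ _ (fun i => (i < nth 0 la c)%N)) => [|i]; last by rewrite /= ltn_clen.
have : (nth 0 la c <= head 0 la)%N.
  have [cl|lc] := ltnP c (size la); last by rewrite nth_default.
  by rewrite parts_le_head // mem_nth.
move: (nth 0%N la c) (head 0%N la) => k N.
elim: N k => [|N IH] k; first by rewrite leqn0 => /eqP ->.
rewrite leq_eqVlt -addn1 iotaD count_cat /= addn0 => /predU1P[->|kN].
  rewrite (@eq_in_count _ _ predT) ?count_predT ?size_iota; first by lia.
  by move=> i; rewrite mem_iota /=; lia.
by rewrite IH 1?ltnNge; lia.
Qed.

(** Suffices to undo a double conjugation inside [ctilde], which sees only multiplicities. *)
Lemma mult_conjpK la c : mult (conjp (conjp la)) c = mult la c.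
Proof. by rewrite mult_clen !clen_conjp -/(dmult _ _) dmult_conjp. Qed.

Lemma mult_inj la mu : mult la =1 mult mu -> la = mu.
Proof.
move=> E; apply: val_inj; have /andP[s1 n1] : is_intpart la := valP la.
have /andP[s2 n2] : is_intpart mu := valP mu.
apply: (@sorted_eq _ geq) => //.
- by move=> x y z; rewrite /geq /= => yx zy; apply: leq_trans zy yx.
- by move=> x y; rewrite /geq /= andbC -eqn_leq => /eqP.
apply/allP => -[|c] _ /=; last by apply/eqP/E.
by rewrite (count_memPn n1) (count_memPn n2).
Qed.

Lemma mult_surj (v : nat -> nat) N : (forall c, (N <= c)%N -> v c = 0%N) ->
  exists la, mult la =1 v.
Proof.
move=> v0; pose l := flatten [seq nseq (v c) c.+1 | c <- iota 0 N].
have cl d : count_mem d l = (if 0 < d <= N then v d.-1 else 0)%N.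
  rewrite /l; elim: N {v0 l} => [|N IH]; first by case: d.
  have -> : iota 0 N.+1 = iota 0 N ++ [:: N] by rewrite -addn1 iotaD.
  rewrite map_cat flatten_cat count_cat IH /= cats0 count_nseq /=.
  case: d {IH} => [|d]; rewrite /= ?eqSS //.
  have [->|Nd] := eqVneq N d; first by rewrite ltnn leqnn mul1n.
  by rewrite mul0n addn0 (_ : (d < N)%N = (d < N.+1)%N) //; lia.
have lP : is_intpart (sort geq l).
  rewrite /is_intpart sort_sorted; last by move=> x y; rewrite /geq /=; exact: leq_total.
  by apply/count_memPn; rewrite count_sort cl.
exists (IntPart lP) => c; rewrite /mult /= count_sort cl /=.
by case: ltnP => // /v0.
Qed.

(** The second hypothesis, written without subtraction, says that f - g takes the same value at c
    and c + 1; descending from N, where it is zero, gives equality. *)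
Lemma eventually_eq (f g : nat -> nat) N :
    (forall c, (N <= c)%N -> f c = g c) ->
  (forall c, f c + g c.+1 = g c + f c.+1)%N -> f =1 g.
Proof.
move=> fgN E c; have [/fgN //|cN] := leqP N c.
rewrite -(subKn (ltnW cN)); elim: (N - c)%N => [|k IH]; first by rewrite subn0 fgN.
have [Nk|kN] := leqP N k; first by rewrite (_ : N - k.+1 = N - k)%N //; lia.
have := E (N - k.+1)%N; rewrite (_ : (N - k.+1).+1 = N - k)%N; last by lia.
by rewrite IH; lia.
Qed.

Lemma clen_inj la mu : clen la =1 clen mu -> la = mu.
Proof. by move=> E; apply: mult_inj => c; rewrite !mult_clen !E. Qed.

Lemma clen_eq la (b : nat -> nat) N : (forall c, b c.+1 <= b c)%N ->
    (forall c, (N <= c)%N -> b c = 0%N) ->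
  (forall c, mult la c = b c - b c.+1)%N -> clen la =1 b.
Proof.
move=> b_anti b0 E; apply: (@eventually_eq _ _ (maxn N (head 0%N la))) => c.
  by rewrite geq_max => /andP[/b0 -> /clen_eq0].
by have := E c; rewrite mult_clen; have := b_anti c; have := clen_anti la c; lia.
Qed.

Lemma clen_surj (b : nat -> nat) N : (forall c, b c.+1 <= b c)%N ->
  (forall c, (N <= c)%N -> b c = 0%N) -> exists la, clen la =1 b.
Proof.
move=> b_anti b0.
have [c Nc|la laE] := @mult_surj (fun c => b c - b c.+1)%N N; first by rewrite b0 // sub0n.
by exists la; exact: clen_eq b_anti b0 laE.
Qed.

(** * Manipulation of finitely supported sums *)

Section FiniteSums.
Variable K : fieldType.

(** Only the supports have to correspond bijectively: nothing is asked of h at the zeros of F. *)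
Lemma reindex_fsum (I J : choiceType) (h : I -> J) (P : set I) (Q : set J)
    (F : I -> K) (G : J -> K) :
    (forall i, P i -> F i != 0 -> Q (h i) /\ G (h i) = F i) ->
    (forall i j, P i -> P j -> F i != 0 -> F j != 0 -> h i = h j -> i = j) ->
    (forall j, Q j -> G j != 0 -> exists2 i, P i & h i = j /\ F i = G j) ->
  \sum_(i \in P) F i = \sum_(j \in Q) G j.
Proof.
move=> PQ inj surj; rewrite fsbig_supp [RHS]fsbig_supp.
rewrite (@reindex_fsbig _ _ _ _ _ h (P `&` F @^-1` [set~ 0])) //.
  apply: eq_fsbigr => i; rewrite inE /= => -[Pi /eqP Fi].
  by have [_ ->] := PQ i Pi Fi.
split=> [i [/= Pi /eqP Fi]|i j|j [Qj /= /eqP Gj]].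
- by have [Qi Gi] := PQ i Pi Fi; split=> //=; rewrite Gi; apply/eqP.
- by rewrite !inE => -[Pi /eqP Fi] [Pj /eqP Fj]; exact: inj.
- have [i Pi [hi Fi]] := surj j Qj Gj; exists i => //; split=> //=.
  by rewrite Fi; apply/eqP.
Qed.

Lemma fsum_fin (T : finType) (F : T -> K) : \sum_(t \in [set: T]) F t = \sum_t F t.
Proof.
rewrite (fsbigE (enum T)) ?enum_uniq // => [|t _]; rewrite ?mem_enum //.
by rewrite big_enum_cond /=; apply: eq_bigl => t; rewrite in_setT.
Qed.

Lemma fsprod_nat N (f : nat -> K) : (forall c, (N <= c)%N -> f c = 1) ->
  \big[*%R/1]_(c \in [set: nat]) f c = \prod_(c < N) f c.
Proof.
move=> f1; rewrite fsbig_ord; apply/esym/fsbig_widen => // c [_ /= /negP].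
by rewrite -leqNgt => /f1.
Qed.

Lemma fsum_seq (I : choiceType) (Q : set I) (F : I -> K) (r : seq I) : uniq r ->
    (forall i, Q i -> F i != 0 -> i \in r) -> (forall i, i \in r -> ~ Q i -> F i = 0) ->
  \sum_(i \in Q) F i = \sum_(i <- r) F i.
Proof.
move=> ur sr rs; rewrite fsbig_supp; apply: fsbig_fwiden => //= [i [Qi /eqP Fi]|i [/= ir nQ]].
  exact: sr.
have [Qi|/(rs _ ir) //] := pselect (Q i).
by apply: contrapT => Fi; exact: nQ.
Qed.

(** Finite support turns the sum into one over a duplicate-free list, which is then grouped by the
    values of f. *)
Lemma fsum_fiber (I J : choiceType) (f : J -> I) (Q : set J) (G : J -> K) :
    finite_set (Q `&` G @^-1` [set~ 0]) ->
  \sum_(j \in Q) G j = \sum_(i \in [set: I]) \sum_(j \in Q `&` f @^-1` [set i]) G j.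
Proof.
move=> /finite_seqP[r0 r0E]; pose r := undup r0; have ur : uniq r := undup_uniq _.
have Qr j : Q j -> G j != 0 -> j \in r.
  move=> Qj /eqP Gj; rewrite mem_undup.
  by have : (Q `&` G @^-1` [set~ 0]) j by []; rewrite r0E.
have rQ j : j \in r -> Q j.
  by rewrite mem_undup => jr; have : [set` r0] j by []; rewrite -r0E => -[].
rewrite (fsum_seq (r := r)) //; last by move=> j /rQ.
rewrite (eq_fsbigr (fun i => \sum_(j <- r | f j == i) G j)) => [|i _]; last first.
  rewrite /= -[RHS]big_filter; apply: fsum_seq; rewrite ?filter_uniq //.
    by move=> j [Qj /= fj] Gj; rewrite mem_filter fj eqxx Qr.
  by move=> j; rewrite mem_filter => /andP[/eqP fj /rQ Qj] [].
rewrite (fsum_seq (r := undup (map f r))) ?undup_uniq //; first last.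
- by move=> i _ [].
- move=> i _; apply: contraNT; rewrite mem_undup => ir.
  apply/eqP; apply: big1_seq => j /andP[/eqP fj jr].
  by rewrite -fj map_f in ir.
rewrite (exchange_big_dep xpredT) //= big_seq [RHS]big_seq; apply: eq_bigr => j jr.
under eq_bigl do rewrite eq_sym.
by rewrite -big_filter filter_pred1_uniq ?undup_uniq ?mem_undup ?map_f // big_seq1.
Qed.

Lemma exchange_fsum (I J : choiceType) (F : I -> J -> K) (A : set I) (B : set J) :
    finite_set A -> finite_set B -> (forall i j, F i j != 0 -> A i /\ B j) ->
  \sum_(i \in [set: I]) \sum_(j \in [set: J]) F i j =
  \sum_(j \in [set: J]) \sum_(i \in [set: I]) F i j.
Proof.
move=> fA fB FAB.
have F0A i j : ~ A i -> F i j = 0.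
  by move=> nA; apply/eqP; apply: contrapT => /negP /FAB[].
have F0B i j : ~ B j -> F i j = 0.
  by move=> nB; apply/eqP; apply: contrapT => /negP /FAB[].
transitivity (\sum_(i \in A) \sum_(j \in B) F i j).
  rewrite -(fsbig_widen A setT) //; last by move=> i [_ nA] /=; apply: fsbig1 => j _; exact: F0A.
  by apply: eq_fsbigr => i _; rewrite -(fsbig_widen B setT) // => j [_ nB] /=; exact: F0B.
rewrite exchange_fsbig //; apply/esym.
rewrite -(fsbig_widen B setT) //; last by move=> i [_ nA] /=; apply: fsbig1 => j _; exact: F0B.
by apply: eq_fsbigr => i _; rewrite -(fsbig_widen A setT) // => j [_ nB] /=; exact: F0A.
Qed.

End FiniteSums.

(** * One-variable operators *)

Section Operators.
Variables (K : fieldType) (q s : K).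
Hypothesis q_neq1 : forall k, 1 - q ^+ k.+1 != 0.
Hypothesis s2_neq1 : forall k, 1 - s ^+ 2 * q ^+ k != 0.

Let qq_neq0 := qpochq_neq0 q_neq1.
Let qs_neq0 := qpochs_neq0 s2_neq1.

(** Conservation at each vertex, summed from infinity, makes the horizontal edges the differences of
    column lengths. *)
Lemma Ct_term_clen u mu la (h : nat -> bool) : s * u != 1 -> eventually_is false h ->
  Ct_term q s u mu la h != 0 -> forall c, clen la c = (clen mu c + h c)%N.
Proof.
move=> su eh t0; have [N hN] := eh.
apply: (@eventually_eq _ _ (maxn N (maxn (head 0%N mu) (head 0%N la)))) => [c|c].
  by rewrite !geq_max => /and3P[/hN -> /clen_eq0 -> /clen_eq0 ->].
have := Ct_term_conserve su eh t0 c; rewrite !mult_clen.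
by have := clen_anti la c; have := clen_anti mu c; lia.
Qed.

Lemma Ct_neq0_clen u mu la : s * u != 1 -> Ct q s u mu la != 0 ->
  exists t : nat -> bool, forall c, clen la c = (clen mu c + t c)%N.
Proof. by move=> su /fssum_neq0[h eh t0]; exists h; exact: Ct_term_clen eh t0. Qed.

(** By [Ct_term_clen], the sum over h collapses to the single term h = t. *)
Lemma Ct_fin u mu la N (t : nat -> bool) : s * u != 1 ->
    (forall c, clen la c = (clen mu c + t c)%N) ->
    (forall c, (N <= c)%N -> clen la c = 0%N) ->
  Ct q s u mu la = u ^+ t 0%N *
    \prod_(c < N) wt q s u (clen mu c - clen mu c.+1) (t c) (clen la c - clen la c.+1) (t c.+1).
Proof.
move=> su laE la0; have et c : (N <= c)%N -> t c = false.
  by move=> /la0; rewrite laE; case: (t c) => //; lia.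
have mu0 c : (N <= c)%N -> clen mu c = 0%N by move=> /la0; rewrite laE; lia.
transitivity (Ct_term q s u mu la t); last first.
  congr (_ * _); rewrite (fsprod_nat (N := N)) => [|c Nc]; last first.
    rewrite !mult_clen !mu0 ?la0 ?et ?(leqW Nc) // /wt /= expr0 mulr1 divff //.
    by rewrite subr_eq0 eq_sym.
  by apply: eq_bigr => c _; rewrite !mult_clen.
rewrite -(fsbig_set1 +%R t (Ct_term q s u mu la)).
apply/esym/fsbig_widen => [_ -> /=|h [/= eh ht]]; first by exists N.
apply/eqP; apply: contrapT => /negP h0; apply: ht; apply/funext => c.
by have := Ct_term_clen su eh h0 c; rewrite laE; case: (t c); case: (h c) => //=; lia.
Qed.

(** Equivalently, la/nu is a vertical strip. *)
Definition interlaced (nu la : intpart) : Prop :=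
  forall c, (clen la c.+1 <= clen nu c <= clen la c)%N.

(* The transfer operator of a single row of the lattice defining [qW], indexed
   by the conjugates of the partitions above and below that row. *)
Definition row_op (x : K) (nu la : intpart) : K :=
  if `[< interlaced nu la >] then
    xpoch q s x (clen la 0 - clen nu 0) / qpoch q q (clen la 0 - clen nu 0) *
    \big[*%R/1]_(c \in [set: nat])
      Wt q s x (mult nu c) (clen la c - clen nu c) (mult la c) (clen la c.+1 - clen nu c.+1)
  else 0.

(** The larger partition comes first: [Ct] raises partitions and [dual_op] lowers them, so that the
    two compose as matrices. *)
Definition dual_op (x : K) (la nu : intpart) : K :=
  ctilde q s la / ctilde q s nu * row_op x nu la.

Lemma ctilde_fin la N : (forall c, (N <= c)%N -> clen la c = 0%N) ->
  ctilde q s la = \prod_(c < N) (qpoch q (s ^+ 2) (mult la c) / qpoch q q (mult la c)).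
Proof.
move=> la0; apply: fsprod_nat => c Nc.
by rewrite mult_clen !la0 ?(leqW Nc) // /qpoch !big_ord0 divr1.
Qed.

Lemma ctilde_neq0 la : ctilde q s la != 0.
Proof.
rewrite (@ctilde_fin _ (head 0%N la)) => [|c]; last exact: clen_eq0.
by apply/prodf_neq0 => c _; rewrite mulf_neq0 ?invr_neq0.
Qed.

Lemma dual_op_neq0 x la nu : dual_op x la nu != 0 -> interlaced nu la.
Proof.
rewrite /dual_op /row_op; case: asboolP => //.
by rewrite mulr0 eqxx.
Qed.

Lemma dual_op_fin x la nu N : interlaced nu la ->
    (forall c, (N < c)%N -> clen la c = 0%N) -> (forall c, (N <= c)%N -> clen nu c = 0%N) ->
  dual_op x la nu =
    xpoch q s x (clen la 0 - clen nu 0) / qpoch q q (clen la 0 - clen nu 0) *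
    \prod_(c < N) Wd q s x (clen nu c - clen nu c.+1) (clen la c.+1 - clen nu c.+1)
       (clen nu c - clen la c.+1).
Proof.
move=> il la0 nu0; have la0' c : (N < c)%N -> clen la c = 0%N := la0 c.
have nu0' c : (N < c)%N -> clen nu c = 0%N by move/ltnW/nu0.
rewrite /dual_op /row_op asboolT // mulrCA; congr (_ * _).
rewrite (ctilde_fin la0') (ctilde_fin nu0') (fsprod_nat (N := N.+1)) => [|c Nc]; last first.
  by rewrite !mult_clen !la0 ?nu0' ?(leqW Nc) // /Wt /= /xpoch /qpoch !big_ord0 !mulr1 divr1.
rewrite -prodf_div -big_split /= big_ord_recr /=.
(* At column N only la can be nonzero: with k = [clen la N], the weight [Wt] is (q;q)_k/(s^2;q)_k,
   inverse to the factor of [ctilde] at N. *)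
set last := (X in _ * X = _); suff -> : last = 1.
  rewrite mulr1; apply: eq_bigr => c _; rewrite /Wt /Wd !mult_clen.
  have := il c; have := il c.+1; have := clen_anti la c; have := clen_anti nu c => a1 a2 a3 a4.
  rewrite ifT; last by lia.
  rewrite (_ : (clen nu c - clen nu c.+1 - _ = clen nu c - clen la c.+1)%N); last by lia.
  field; rewrite !qq_neq0 !qs_neq0 //.
rewrite /last /Wt !mult_clen !(la0 N.+1) // (nu0 N) // (nu0 N.+1) // !subn0 add0n addn0 eqxx /=.
rewrite [xpoch _ _ _ 0]big_ord0 ![qpoch _ _ 0]big_ord0.
by field; rewrite ?qq_neq0 ?qs_neq0 ?oner_neq0.
Qed.

End Operators.

(** * The case of one variable on each side *)

Section Commutation.
Variables (K : fieldType) (q s : K).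
Hypothesis q_neq1 : forall k, 1 - q ^+ k.+1 != 0.
Hypothesis s2_neq1 : forall k, 1 - s ^+ 2 * q ^+ k != 0.
Variables (u x : K) (mu nu : intpart).
Hypothesis su : s * u != 1.

Let su' : 1 - s * u != 0.
Proof. by rewrite subr_eq0 eq_sym. Qed.

Let N := maxn (head 0%N mu) (head 0%N nu).
Let mu0 c : (N <= c)%N -> clen mu c = 0%N.
Proof. by rewrite geq_max => /andP[/clen_eq0]. Qed.
Let nu0 c : (N <= c)%N -> clen nu c = 0%N.
Proof. by rewrite geq_max => /andP[_ /clen_eq0]. Qed.

Let WM i := colM q s u x (clen mu i) (clen mu i.+1) (clen nu i) (clen nu i.+1).
Let WN i := colN q s u x (clen mu i) (clen mu i.+1) (clen nu i) (clen nu i.+1).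
(** Right boundary vectors at column N, where mu and nu vanish. A partition la above them may still
    have h = 1 there, and its weight in [Ct] equals the entry of X_N from h to 0; a partition ka
    below has g = 0. *)
Let vM (h : bool) := Rmx q s u x h false h.
Let vN (g : bool) : K := (~~ g)%:R.
Let init (h : bool) : K := if (clen nu 0 <= clen mu 0 + h)%N
  then ell q s u x (clen mu 0 + h - clen nu 0) h else 0.

(** Codes an intermediate partition by its differences with the outer one; in every nonzero term
    these vanish beyond column N. *)
Let bits (la ka : intpart) : N.+1.-tuple bool := [tuple (clen la i < clen ka i)%N | i < N.+1].

Let nth_bits la ka c : nth false (bits la ka) c = (c <= N)%N && (clen la c < clen ka c)%N.
Proof.
have [cN|Nc] := leqP c N; last by rewrite nth_default ?size_tuple.
have cN' : (c < N.+1)%N by [].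
by rewrite -[c]/(nat_of_ord (Ordinal cN')) -tnth_nth tnth_mktuple.
Qed.

Let dual_CtE la (t : nat -> bool) : (forall c, clen la c = clen mu c + t c)%N ->
  interlaced nu la ->
  Ct q s u mu la * dual_op q s x la nu = init (t 0%N) * path_weight WM vM N 0 t.
Proof.
move=> laE il.
have la0 c : (N < c)%N -> clen la c = 0%N.
  by case: c => // c /nu0 E; have := il c; rewrite E; lia.
rewrite (Ct_fin q su laE la0) (dual_op_fin q_neq1 s2_neq1 _ il la0 nu0).
rewrite big_ord_recr /= /init /path_weight -!laE ifT; last by have := il 0%N; lia.
have tN : t N.+1 = false by have := laE N.+1; rewrite la0 //; case: (t _) => //; lia.
have -> : \prod_(j < N) WM (0 + j) (t j) (t j.+1) =
    (\prod_(j < N) wt q s u (clen mu j - clen mu j.+1) (t j) (clen la j - clen la j.+1) (t j.+1)) *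
    \prod_(j < N) Wd q s x (clen nu j - clen nu j.+1) (clen la j.+1 - clen nu j.+1)
       (clen nu j - clen la j.+1).
  rewrite -big_split; apply: eq_bigr => j _.
  by rewrite /WM /colM add0n -!laE ifT //; have := il j; have := il j.+1; lia.
have -> : vM (t N) = wt q s u (clen mu N - clen mu N.+1) (t N) (clen la N - clen la N.+1) (t N.+1).
  rewrite tN laE la0 // !mu0 // add0n !subn0 /vM; case: (t N).
    by rewrite wt10.
  by rewrite wt00 /Rmx; congr (_ / _); ring.
by rewrite /ell; ring.
Qed.

Let Ct_dualE ka (t : nat -> bool) : (forall c, clen nu c = clen ka c + t c)%N ->
  interlaced ka mu ->
  dual_op q s x mu ka * Ct q s u ka nu = init (t 0%N) * path_weight WN vN N 0 t.
Proof.
move=> kaE il.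
have ka0 c : (N <= c)%N -> clen ka c = 0%N by move=> /nu0; rewrite kaE; lia.
have tN : t N = false by have := kaE N; rewrite nu0 //; case: (t _) => //; lia.
rewrite (Ct_fin q su kaE nu0) (dual_op_fin q_neq1 s2_neq1 _ il (fun c Nc => mu0 (ltnW Nc)) ka0).
rewrite /path_weight tN /vN /= mulr1 /init ifT; last by have := il 0%N; rewrite kaE; lia.
rewrite /ell (_ : (_ + t 0 - _ = clen mu 0 - clen ka 0)%N); last by rewrite kaE; lia.
have -> : \prod_(j < N) WN (0 + j) (t j) (t j.+1) =
    (\prod_(j < N) wt q s u (clen ka j - clen ka j.+1) (t j) (clen nu j - clen nu j.+1) (t j.+1)) *
    \prod_(j < N) Wd q s x (clen ka j - clen ka j.+1) (clen mu j.+1 - clen ka j.+1)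
       (clen ka j - clen mu j.+1).
  rewrite -big_split; apply: eq_bigr => j _.
  have := il j; have := il j.+1; have := kaE j; have := kaE j.+1.
  rewrite /WN /colN add0n => e1 e2 i1 i2.
  by rewrite ifT; [congr (wt _ _ _ _ _ _ _ * Wd _ _ _ _ _ _) |]; lia.
by ring.
Qed.

(** Both sums are transported to bit tuples and compared by [tuple_exchange]. Conversely, the
    inequalities built into the nonzero weights make each such tuple come from a partition. *)
Lemma Ct_dual_exchange :
  \sum_(la \in [set: intpart]) Ct q s u mu la * dual_op q s x la nu =
  (1 + u * x) / (1 - s * u) *
  \sum_(ka \in [set: intpart]) dual_op q s x mu ka * Ct q s u ka nu.
Proof.
have end_v h : vM h = \sum_(g : bool)
    Rmx q s u x h g (clen mu N + h - clen nu N) * vN g.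
  by rewrite big_bool /= mulr0 add0r mulr1 mu0 // nu0 // subn0.
have := tuple_exchange q_neq1 s2_neq1 su' (clen_anti mu) (clen_anti nu) end_v.
rewrite -!fsum_fin => E; rewrite -/WM -/WN -/init in E.
rewrite (reindex_fsum (h := bits mu) (Q := setT)
  (G := fun t : N.+1.-tuple bool => init (nth false t 0) * path_weight WM vM N 0 (nth false t))).
- rewrite E; congr (_ * _); apply/esym.
  apply: (reindex_fsum (h := fun ka => bits ka nu)).
  + move=> ka _; rewrite mulf_eq0 negb_or => /andP[/dual_op_neq0 il /(Ct_neq0_clen su)[t kaE]].
    split=> //; rewrite (Ct_dualE (t := nth false (bits ka nu))) // => c.
    rewrite nth_bits kaE; have [cN|Nc] := leqP c N; first by case: (t c); lia.
    by have := nu0 (ltnW Nc); rewrite kaE /=; lia.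
  + move=> la ka _ _.
    rewrite mulf_eq0 negb_or => /andP[/dual_op_neq0 il /(Ct_neq0_clen su)[t laE]].
    rewrite mulf_eq0 negb_or => /andP[/dual_op_neq0 il' /(Ct_neq0_clen su)[t' kaE]] Eb.
    apply: clen_inj => c; have := congr1 (fun b : N.+1.-tuple bool => nth false b c) Eb.
    rewrite !nth_bits; have := laE c; have := kaE c; have [cN|Nc] /= := leqP c N.
      by case: (t c); case: (t' c); lia.
    by rewrite (nu0 (ltnW Nc)); lia.
  + move=> t _ t0.
    have /= [i0 w0 tN] : [/\ init (nth false t 0) != 0,
      forall j : 'I_N, WN j (nth false t j) (nth false t j.+1) != 0 & nth false t N = false].
      move: t0; rewrite /path_weight !mulf_eq0 !negb_or => /and3P[-> /prodf_neq0 w0 v0].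
      split=> // [j|]; first by have := w0 j isT; rewrite add0n.
      by move: v0; rewrite /vN; case: nth; rewrite ?eqxx.
    have {}w0 c : (c < N)%N -> (clen nu c.+1 <= clen mu c.+1 + nth false t c.+1)%N /\
        (clen mu c.+1 + nth false t c <= clen nu c)%N.
      move=> cN; have := w0 (Ordinal cN); rewrite /WN /colN /=.
      by case: ifP => [/andP[] //|_]; rewrite eqxx.
    have {}i0 : (clen nu 0 <= clen mu 0 + nth false t 0)%N.
      by move: i0; rewrite /init; case: ifP => //; rewrite eqxx.
    have t_out c : (N <= c)%N -> nth false t c = false.
      rewrite leq_eqVlt => /predU1P[<- //|Nc]; by rewrite nth_default ?size_tuple.
    (* This subtraction is never truncated: a nonzero [colN] forces mu_{c+1} + t_c <= nu_c for c <
       N, and t_c = 0 from N on. *)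
    pose b c := (clen nu c - nth false t c)%N.
    have tb c : (clen nu c = b c + nth false t c)%N.
      have [Nc|cN] := leqP N c; first by rewrite /b t_out //= subn0 addn0.
      by have [] := w0 c cN; rewrite /b; lia.
    have b_mu c : (b c <= clen mu c)%N.
      case: c => [|c]; first by have := tb 0%N; lia.
      have [Nc|cN] := leqP N c; first by rewrite /b nu0 // leqW.
      by have [] := w0 c cN; have := tb c.+1; lia.
    have mu_b c : (clen mu c.+1 <= b c)%N.
      have [Nc|cN] := leqP N c; first by rewrite mu0 // leqW.
      by have [] := w0 c cN; have := tb c; lia.
    have [|c Nc|ka kaE] := @clen_surj b N.
    - by move=> c; apply: leq_trans (b_mu c.+1) (mu_b c).
    - by rewrite /b nu0.
    exists ka => //; split; last first.
      apply: Ct_dualE => c; first by rewrite kaE.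
      by rewrite kaE mu_b b_mu.
    apply: val_inj; apply: (@eq_from_nth _ false); rewrite ?size_tuple // => c cN.
    rewrite nth_bits -ltnS cN kaE tb; by case: nth => /=; lia.
- move=> la _; rewrite mulf_eq0 negb_or => /andP[/(Ct_neq0_clen su)[t laE] /dual_op_neq0 il].
  split=> //; rewrite (dual_CtE (t := nth false (bits mu la))) // => c.
  rewrite nth_bits laE; have [cN|Nc] := leqP c N; first by case: (t c); lia.
  by case: c Nc => // c /nu0 nuc; have := il c; rewrite nuc laE; lia.
- move=> la ka _ _.
  rewrite mulf_eq0 negb_or => /andP[/(Ct_neq0_clen su)[t laE] /dual_op_neq0 il].
  rewrite mulf_eq0 negb_or => /andP[/(Ct_neq0_clen su)[t' kaE] /dual_op_neq0 il'] Eb.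
  apply: clen_inj => c; have := congr1 (fun b : N.+1.-tuple bool => nth false b c) Eb.
  rewrite !nth_bits laE kaE; have [cN|Nc] /= := leqP c N.
    by case: (t c); case: (t' c); lia.
  case: c Nc => // c /nu0 nuc _; have := il c; have := il' c.
  by rewrite nuc laE kaE; lia.
- move=> t _ t0.
  have /= [i0 w0] : init (nth false t 0) != 0 /\
    forall j : 'I_N, WM j (nth false t j) (nth false t j.+1) != 0.
    move: t0; rewrite /path_weight !mulf_eq0 !negb_or => /and3P[-> /prodf_neq0 w0 v0].
    by split=> // j; have := w0 j isT; rewrite add0n.
  pose b c := (clen mu c + nth false t c)%N.
  have {}w0 c : (c < N)%N -> (clen nu c.+1 <= b c.+1 <= clen nu c)%N.
    move=> cN; have := w0 (Ordinal cN); rewrite /WM /colM /=.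
    by case: ifP => //; rewrite eqxx.
  have b_out c : (N < c)%N -> b c = 0%N.
    by move=> Nc; rewrite /b nth_default ?size_tuple // mu0 // ltnW.
  have nu_b c : (clen nu c <= b c)%N.
    case: c => [|c]; first by move: i0; rewrite /init; case: ifP => //; rewrite eqxx.
    have [Nc|cN] := leqP N c; first by rewrite nu0 // leqW.
    by have /andP[] := w0 c cN.
  have b_nu c : (b c.+1 <= clen nu c)%N.
    have [Nc|cN] := leqP N c; first by rewrite b_out.
    by have /andP[] := w0 c cN.
  (* The bound is N + 1 because la may have one column more than mu and nu. *)
  have [||la laE] := @clen_surj b N.+1 => //.
    by move=> c; apply: leq_trans (b_nu c) (nu_b c).
  exists la => //; split; last first.
    apply: dual_CtE => c; first by rewrite laE.
    by rewrite !laE b_nu nu_b.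
  apply: val_inj; apply: (@eq_from_nth _ false); rewrite ?size_tuple // => c cN.
  by rewrite nth_bits -ltnS cN laE /b; case: nth => /=; lia.
Qed.

End Commutation.

(** * Products of operators *)

Section Compose.
Variable K : fieldType.
Implicit Types A B C : intpart -> intpart -> K.

Definition opmul A B (i j : intpart) : K := \sum_(k \in [set: intpart]) A i k * B k j.

(* Enough to make the sums defining products of such operators finite: along a
   nonzero entry the length grows, and the largest part drops, by a bounded
   amount. *)
Definition bounded A : Prop := exists b, forall i j, A i j != 0 ->
  (size j <= size i + b)%N /\ (head 0%N i <= head 0%N j + b)%N.

Lemma opmul_neq0 A B i j : opmul A B i j != 0 -> exists k, A i k != 0 /\ B k j != 0.
Proof. by move=> /fssum_neq0[k _]; rewrite mulf_eq0 negb_or => /andP; exists k. Qed.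

Lemma bounded_opmul A B : bounded A -> bounded B -> bounded (opmul A B).
Proof.
move=> [a Aa] [b Bb]; exists (a + b)%N => i j /opmul_neq0[k [/Aa + /Bb]]; lia.
Qed.

(** The intermediate partitions lie in a finite box: their lengths are bounded in terms of i, their
    largest parts in terms of j. *)
Lemma opmulA A B C : bounded A -> bounded B -> bounded C ->
  opmul A (opmul B C) = opmul (opmul A B) C.
Proof.
move=> [a Aa] [b Bb] [c Cc]; apply/funext => i; apply/funext => j.
rewrite /opmul; under eq_fsbigr do rewrite mulr_fsumr.
under [RHS]eq_fsbigr do rewrite mulr_fsuml.
have fin := finite_intpart (size i + a + b) (head 0%N j + b + c)%N.
rewrite (exchange_fsum fin fin) => [|k l].
  by apply: eq_fsbigr => k _; apply: eq_fsbigr => l _; rewrite mulrA.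
by rewrite !mulf_eq0 !negb_or => /and3P[/Aa + /Bb + /Cc] /=; lia.
Qed.

Definition qcommute (f : K) A B : Prop := forall i j, opmul A B i j = f * opmul B A i j.

(** B is moved past A' and then past A, and the scalars multiply. *)
Lemma qcommute_compl f f' A A' B : bounded A -> bounded A' -> bounded B ->
  qcommute f A B -> qcommute f' A' B -> qcommute (f * f') (opmul A A') B.
Proof.
move=> bA bA' bB AB AB' i j; rewrite -opmulA //.
have -> : opmul A (opmul A' B) i j = f' * opmul A (opmul B A') i j.
  by rewrite mulr_fsumr; apply: eq_fsbigr => k _; rewrite AB' mulrCA.
rewrite (opmulA bA bB bA') (opmulA bB bA bA') [f * f']mulrC -!mulrA; congr (_ * _).
by rewrite mulr_fsumr; apply: eq_fsbigr => k _; rewrite AB mulrA.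
Qed.

Lemma qcommute_compr f f' A B B' : bounded A -> bounded B -> bounded B' ->
  qcommute f A B -> qcommute f' A B' -> qcommute (f * f') A (opmul B B').
Proof.
move=> bA bB bB' AB AB' i j; rewrite opmulA //.
have -> : opmul (opmul A B) B' i j = f * opmul (opmul B A) B' i j.
  by rewrite mulr_fsumr; apply: eq_fsbigr => k _; rewrite AB mulrA.
rewrite -(opmulA bB bA bB') -(opmulA bB bB' bA) -!mulrA; congr (_ * _).
by rewrite mulr_fsumr; apply: eq_fsbigr => k _; rewrite AB' mulrCA.
Qed.

Definition id_op (i j : intpart) : K := (i == j)%:R.

Lemma bounded_id_op : bounded id_op.
Proof.
by exists 0%N => i j; rewrite /id_op; case: (eqVneq i j) => [->|_]; rewrite ?addn0 // eqxx.
Qed.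

Lemma opmul_idl A : opmul id_op A = A.
Proof.
apply/funext => i; apply/funext => j; rewrite /opmul (fsum_seq (r := [:: i])) //.
- by rewrite big_seq1 /id_op eqxx mul1r.
- by move=> k _; rewrite /id_op inE eq_sym; case: (eqVneq k i) => // _; rewrite mul0r eqxx.
- by move=> k _ [].
Qed.

Lemma opmul_idr A : opmul A id_op = A.
Proof.
apply/funext => i; apply/funext => j; rewrite /opmul (fsum_seq (r := [:: j])) //.
- by rewrite big_seq1 /id_op eqxx mulr1.
- by move=> k _; rewrite /id_op inE; case: (eqVneq k j) => // _; rewrite mulr0 eqxx.
- by move=> k _ [].
Qed.

End Compose.

(** * Sums over chains of partitions as operator products *)

Section Chains.
Variable K : fieldType.

Definition chain_sum m (A : 'I_m -> intpart -> intpart -> K) (mu la : intpart) : K :=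
  \sum_(ch \in @chains m mu la)
    \prod_(r < m) A r (ch (lift ord_max r)) (ch (lift ord0 r)).

(** Confines a chain of nonzero weight to a finite box given by its last partition. *)
Definition increasing (A : intpart -> intpart -> K) : Prop :=
  forall i j, A i j != 0 -> (size i <= size j)%N /\ (head 0%N i <= head 0%N j)%N.

Lemma chain_sum0 (A : 'I_0 -> intpart -> intpart -> K) : chain_sum A = id_op K.
Proof.
apply/funext => mu; apply/funext => la; rewrite /chain_sum /id_op.
have [<-|ne] := eqVneq mu la; last first.
  apply: fsbig1 => ch [c0 c1]; case/eqP: ne; rewrite -c0 -c1; congr ch; exact: val_inj.
rewrite (fsum_seq (r := [:: fun=> mu])) //.
- by rewrite big_seq1 big_ord0.
- move=> ch [c0 _] _; rewrite inE; apply/eqP/funext => r.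
  by rewrite -c0; congr ch; rewrite ord1; exact: val_inj.
- by move=> ch; rewrite inE => /eqP -> [].
Qed.

Lemma finite_chain_support m (A : 'I_m -> intpart -> intpart -> K) mu la :
    (forall r, increasing (A r)) ->
  finite_set (@chains m mu la `&`
    (fun ch => \prod_(r < m) A r (ch (lift ord_max r)) (ch (lift ord0 r))) @^-1` [set~ 0]).
Proof.
move=> A_inc; apply: sub_finite_set (finite_ffun 'I_m.+1 (finite_intpart (size la) (head 0%N la))).
move=> ch [[_ <-] /= /eqP/prodf_neq0 A0]; apply: ord_ind_down => // r.
by have := A_inc _ _ _ (A0 r isT); lia.
Qed.

(** Chains are grouped by their last but one partition, the value at [lift ord_max ord_max]. *)
Lemma chain_sum_recr m (A : 'I_m.+1 -> intpart -> intpart -> K) :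
    (forall r, increasing (A r)) ->
  chain_sum A = opmul (chain_sum (fun r => A (widen_ord (leqnSn m) r))) (A ord_max).
Proof.
move=> A_inc; apply/funext => mu; apply/funext => la.
rewrite /chain_sum (fsum_fiber (fun ch => ch (lift ord_max ord_max))); last first.
  exact: finite_chain_support.
apply: eq_fsbigr => ka _; rewrite mulr_fsuml.
have w0 (r : 'I_m) : lift ord_max (widen_ord (leqnSn m) r) = lift ord_max (lift ord_max r).
  by apply: val_inj; rewrite /= /bump; have := ltn_ord r; lia.
have w1 (r : 'I_m) : lift ord0 (widen_ord (leqnSn m) r) = lift ord_max (lift ord0 r).
  by apply: val_inj; rewrite /= /bump; have := ltn_ord r; lia.
have lmax : lift ord0 ord_max = ord_max :> 'I_m.+2 by apply: val_inj.
have l0 : lift ord_max ord0 = ord0 :> 'I_m.+2 by apply: val_inj.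
apply: (reindex_fsum (h := fun ch r => ch (lift ord_max r))).
- move=> ch [[c0 c1] /= c2] _; split; first by split; rewrite ?l0.
  rewrite big_ord_recr /= c2 lmax c1; congr (_ * _).
  by apply: eq_bigr => r _; rewrite w0 w1.
- move=> ch ch' [[_ c1] _] [[_ c1'] _] _ _ E; apply/funext => r.
  by case: (unliftP ord_max r) => [r'|] ->; [exact: (congr1 (fun f => f r') E)|rewrite c1 c1'].
- move=> ch [c0 c1] _; exists (fun r => if unlift ord_max r is Some r' then ch r' else la).
    by split; [split; rewrite ?unlift_none // -l0 liftK|rewrite /= liftK].
  split; first by apply/funext => r; rewrite liftK.
  rewrite big_ord_recr /= lmax unlift_none liftK c1; congr (_ * _).
  by apply: eq_bigr => r _; rewrite w0 w1 !liftK.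
Qed.

End Chains.

(** * From one variable to several *)

Section Cauchy.
Variables (K : fieldType) (q s : K).
Hypothesis q_neq1 : forall k, 1 - q ^+ k.+1 != 0.
Hypothesis s2_neq1 : forall k, 1 - s ^+ 2 * q ^+ k != 0.

Lemma row_op_neq0 x nu la : row_op q s x nu la != 0 -> interlaced nu la.
Proof. by rewrite /row_op; case: asboolP => //; rewrite eqxx. Qed.

Lemma interlaced_size nu la : interlaced nu la ->
  [/\ (size nu <= size la)%N, (head 0 nu <= head 0 la)%N & (head 0 la <= (head 0 nu).+1)%N].
Proof.
move=> il; split.
- by rewrite !size_clen; have /andP[] := il 0%N.
- by rewrite head_clen; have /andP[_] := il (head 0%N la); rewrite [clen la _]clen_eq0 // leqn0.
- by rewrite head_clen; have /andP[+ _] := il (head 0%N nu); rewrite [clen nu _]clen_eq0 // leqn0.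
Qed.

(* The numbers of horizontal edges are determined by the vertical ones, so that
   a configuration is a chain of partitions. *)
Lemma qW_chain_sum n (x : 'I_n -> K) (la nu : intpart) :
  qW q s (conjp la) (conjp nu) x = chain_sum (fun r => row_op q s (x r)) nu la.
Proof.
pose conf (ch : 'I_n.+1 -> intpart) : qW_config n :=
  (fun r c => (clen (ch (lift ord0 r)) c - clen (ch (lift ord_max r)) c)%N,
   fun r c => mult (ch r) c).
have confE (ch : 'I_n.+1 -> intpart) :
    (forall r, interlaced (ch (lift ord_max r)) (ch (lift ord0 r))) ->
  \prod_(r < n) qW_row q s x (conf ch) r =
  \prod_(r < n) row_op q s (x r) (ch (lift ord_max r)) (ch (lift ord0 r)).
  by move=> il; apply: eq_bigr => r _; rewrite /row_op asboolT.
apply/esym/(reindex_fsum (h := conf)) => [ch [c0 c1] /prodf_neq0 F0|ch ch' _ _ _ _ E|].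
- split; last by apply: confE => r; exact: row_op_neq0 (F0 r isT).
  split=> /= [r|r||].
  + exists (head 0%N (ch (lift ord0 r))) => c hc; by rewrite (clen_eq0 hc).
  + by exists (head 0%N (ch r)) => c /mult0.
  + by rewrite c0; apply/funext => c; rewrite dmult_conjp.
  + by rewrite c1; apply/funext => c; rewrite dmult_conjp.
- by apply/funext => r; apply: mult_inj => c; exact: (congr1 (fun hv : qW_config n => hv.2 r c) E).
move=> [h v] chv F0; have rows := qW_term_conserve chv F0.
have [/= eh ev v0 v1] := chv; simpl in rows.
have /choice[ch chE] : forall r, exists ka, mult ka =1 v r.
  by move=> r; have [N vN] := ev r; exact: mult_surj vN.
(* Conservation and vanishing at infinity identify h with the differences of column lengths. *)
have hE r c : clen (ch (lift ord0 r)) c = (clen (ch (lift ord_max r)) c + h r c)%N.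
  have [N hN] := eh r; move: c.
  apply: (@eventually_eq _ _ (maxn N (maxn (head 0%N (ch (lift ord0 r)))
    (head 0%N (ch (lift ord_max r)))))) => c.
    by rewrite !geq_max => /and3P[/hN -> /clen_eq0 -> /clen_eq0 ->].
  have [+ _] := rows r c; rewrite -!chE !mult_clen.
  by have := clen_anti (ch (lift ord0 r)) c; have := clen_anti (ch (lift ord_max r)) c; lia.
have conf_ch : conf ch = (h, v).
  congr (_, _); apply/funext => r; apply/funext => c; last exact: chE.
  by rewrite hE addKn.
exists ch.
  by split; apply: mult_inj => c; rewrite chE (v0, v1) dmult_conjp.
split=> //; rewrite -conf_ch confE // => r c.
(* The constraint l <= i of [Wt] is the lower interlacing inequality. *)
have [_ +] := rows r c; rewrite -chE mult_clen !hE leq_addr andbT.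
by have := clen_anti (ch (lift ord_max r)) c; lia.
Qed.

Definition dual_sum n (x : 'I_n -> K) (la nu : intpart) : K :=
  qW_dual q s (conjp la) (conjp nu) x.

Lemma dual_sumE n (x : 'I_n -> K) la nu : dual_sum x la nu =
  ctilde q s la / ctilde q s nu * chain_sum (fun r => row_op q s (x r)) nu la.
Proof.
have ctE ka : ctilde q s (conjp (conjp ka)) = ctilde q s ka.
  by apply: eq_fsbigr => c _; rewrite mult_conjpK.
by rewrite /dual_sum /qW_dual qW_chain_sum !ctE.
Qed.

Lemma dual_sum0 (x : 'I_0 -> K) : dual_sum x = id_op K.
Proof.
apply/funext => la; apply/funext => nu; rewrite dual_sumE chain_sum0 /id_op eq_sym.
by case: eqVneq => [->|_]; rewrite ?mulr0 // mulr1 divff // ctilde_neq0.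
Qed.

(** The factors [ctilde] of the intermediate partition cancel. The last variable stands leftmost
    because [dual_op] reads the chain from its larger end. *)
Lemma dual_sum_recr n (x : 'I_n.+1 -> K) :
  dual_sum x = opmul (dual_op q s (x ord_max))
                    (dual_sum (fun r => x (widen_ord (leqnSn n) r))).
Proof.
apply/funext => la; apply/funext => nu; rewrite dual_sumE chain_sum_recr; last first.
  by move=> r i j /row_op_neq0 /interlaced_size[].
rewrite mulr_fsumr; apply: eq_fsbigr => ka _; rewrite dual_sumE /dual_op.
by field; rewrite !ctilde_neq0.
Qed.

Lemma bounded_dual_op x : bounded (dual_op q s x).
Proof. by exists 1%N => la nu /dual_op_neq0 /interlaced_size[]; lia. Qed.

Lemma bounded_dual_sum n (x : 'I_n -> K) : bounded (dual_sum x).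
Proof.
elim: n x => [|n IH] x; first by rewrite dual_sum0; exact: bounded_id_op.
by rewrite dual_sum_recr; apply: bounded_opmul (bounded_dual_op _) (IH _).
Qed.

Lemma bounded_Ct u : s * u != 1 -> bounded (Ct q s u).
Proof. by move=> su; exists 1%N => mu la /(Ct_neq0 su)[]; lia. Qed.

Definition sHL_sum m (u : 'I_m -> K) (mu la : intpart) : K := sHL q s la mu u.

Lemma sHL_sum_recr m (u : 'I_m.+1 -> K) : (forall i, s * u i != 1) ->
  sHL_sum u = opmul (sHL_sum (fun r => u (widen_ord (leqnSn m) r))) (Ct q s (u ord_max)).
Proof.
move=> su; apply: (chain_sum_recr (A := fun r => Ct q s (u r))) => r i j.
by move=> /(Ct_neq0 (su r))[].
Qed.

Lemma bounded_sHL_sum m (u : 'I_m -> K) : (forall i, s * u i != 1) -> bounded (sHL_sum u).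
Proof.
elim: m u => [|m IH] u su.
  by rewrite [sHL_sum u](chain_sum0 (fun r => Ct q s (u r))); exact: bounded_id_op.
by rewrite sHL_sum_recr //; apply: bounded_opmul (IH _ _) (bounded_Ct (su _)) => r.
Qed.

Lemma Ct_dual_sum u n (x : 'I_n -> K) : s * u != 1 ->
  qcommute (\prod_(j < n) ((1 + u * x j) / (1 - s * u))) (Ct q s u) (dual_sum x).
Proof.
move=> su; elim: n x => [|n IH] x.
  by move=> i j; rewrite dual_sum0 opmul_idl opmul_idr big_ord0 mul1r.
(* The scalar of the last variable is put first, as its operator is the left factor. *)
rewrite dual_sum_recr big_ord_recr /= mulrC; apply: qcommute_compr (IH _).
- exact: bounded_Ct.
- exact: bounded_dual_op.
- exact: bounded_dual_sum.
- by move=> i j; exact: Ct_dual_exchange.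
Qed.

Lemma sHL_dual_sum m (u : 'I_m -> K) n (x : 'I_n -> K) : (forall i, s * u i != 1) ->
  qcommute (\prod_(i < m) \prod_(j < n) ((1 + u i * x j) / (1 - s * u i)))
    (sHL_sum u) (dual_sum x).
Proof.
elim: m u => [|m IH] u su.
  rewrite [sHL_sum u](chain_sum0 (fun r => Ct q s (u r))) => i j.
  by rewrite opmul_idl opmul_idr big_ord0 mul1r.
rewrite sHL_sum_recr // big_ord_recr /=; apply: qcommute_compl.
- by apply: bounded_sHL_sum => r.
- exact: bounded_Ct.
- exact: bounded_dual_sum.
- by apply: IH => r.
- exact: Ct_dual_sum.
Qed.

End Cauchy.

Lemma one_minus_neq0 (F : numDomainType) (z : F) : `|z| < 1 -> 1 - z != 0.
Proof.
by apply: contraTneq => /eqP; rewrite subr_eq0 => /eqP <-; rewrite normr1 ltxx.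
Qed.

Theorem theorem7p3 (R : realType) (q s : R[i]) (hq : `|q| < 1) (hs : `|s| < 1)
    (m n : nat) (hm : (0 < m)%N) (hn : (0 < n)%N) (mu nu : intpart)
    (u : 'I_m -> R[i]) (x : 'I_n -> R[i]) (hu : forall i, s * u i != 1) :
  \sum_(la \in [set: intpart])
     sHL q s la mu u * qW_dual q s (conjp la) (conjp nu) x =
  (\prod_(i < m) \prod_(j < n) ((1 + u i * x j) / (1 - s * u i))) *
  \sum_(ka \in [set: intpart])
     sHL q s nu ka u * qW_dual q s (conjp mu) (conjp ka) x.
Proof.
have q_neq1 k : 1 - q ^+ k.+1 != 0.
  by rewrite one_minus_neq0 // normrX exprn_ilt1.
have s2_neq1 k : 1 - s ^+ 2 * q ^+ k != 0.
  rewrite one_minus_neq0 // normrM !normrX; apply: le_lt_trans (_ : `|s| ^+ 2 < 1).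
    by rewrite ler_piMr ?exprn_ge0 // exprn_ile1 // ltW.
  by rewrite exprn_ilt1.
(* The left side is the entry (mu, nu) of an operator product; the reversed product matches the
   right side up to the order of the two factors. *)
rewrite [LHS](sHL_dual_sum q_neq1 s2_neq1 x hu mu nu); congr (_ * _).
by apply: eq_fsbigr => ka _; rewrite mulrC.
Qed.
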